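(* Among the sixteen lattices $U+A_2$, $U(2)+A_2$, $U+A_2+D_4$, $U(2)+A_2+D_4$, $U+E_6(2)$, $U(2)+E_6(2)$, $U+A_2+E_8$, $U(2)+A_2+E_8$, $U+A_2+2D_4$, $U(2)+A_2+2D_4$, $U+A_2+E_8(2)$, $U(2)+A_2+E_8(2)$, $U+A_2+D_4+E_8$, $U(2)+A_2+D_4+E_8$, $U+A_2+2E_8$, $U(2)+A_2+2E_8$ there are exactly 4 chiral lattices: ${U+A_2}$, ${U(2)+A_2}$, ${U+A_2+D_4}$, and ${U+A_2+E_8}$. All the others are achiral.
   Context: These sixteen lattices are exactly the lattices $\mathbb M_+^0(X)$ (invariant part of $H^4$ of a real non-singular cubic fourfold $X$, orthogonal to the polarization) for the coarse deformation classes with even 2-primary discriminant form. $U$ is the hyperbolic plane, $A_n,D_n,E_n$ the positive definite root lattices, $\mathbb L(2)$ the lattice with form multiplied by 2, $+$ orthogonal sum. For such a lattice $\mathbb L$ (even, signature $(n,1)$, $\operatorname{discr}_3\mathbb L=\mathbb Z/3$, $\operatorname{discr}_2$ of period 2), let $W$ be the group generated by reflections in 2-roots ($v^2=2$) and 6-roots ($v^2=6$, $v\cdot\mathbb L\subset3\mathbb Z$); cells $P$ are its fundamental chambers in the hyperbolic space, each lifting to $\pm P^\#$ in the double cover. An automorphism is $P$-direct if it preserves $P^\#$, $\mathbb Z/3$-reversing if it acts as $-\operatorname{id}$ on $\operatorname{discr}_3\mathbb L$. $\mathbb L$ is achiral if it has an automorphism $\mathbb Z/3$-reversing and $P$-direct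 for some cell $P$, chiral otherwise. *)

(* Defs.v *)
From HB Require Import structures.
From mathcomp Require Import all_boot all_order all_algebra.
From mathcomp Require Import all_classical all_reals all_analysis.
From mathcomp Require Import Rstruct Rstruct_topology.
Set Implicit Arguments. Unset Strict Implicit. Unset Printing Implicit Defensive.
Import Order.TTheory GRing.Theory Num.Theory.
Local Open Scope classical_set_scope.
Local Open Scope ring_scope.

Notation RR := Rdefinitions.R.

(* A lattice of rank n is Z^n (row vectors) with an integer Gram matrix G:
   b(x,y) = x *m G *m y^T.  Automorphisms act on row vectors: x |-> x *m g. *)

Definition cartan n (e : 'I_n -> 'I_n -> bool) : 'M[int]_n :=
  \matrix_(i, j) (if i == j then 2 else if e i j || e j i then -1 else 0).

Definition edges n (s : seq (nat * nat)) : 'I_n -> 'I_n -> bool :=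
  fun i j => (nat_of_ord i, nat_of_ord j) \in s.

(* Bourbaki numbering, shifted to 0-based *)
Definition A2 : 'M[int]_2 := cartan (@edges 2 [:: (0,1)]%N).
Definition D4 : 'M[int]_4 := cartan (@edges 4 [:: (1,0); (1,2); (1,3)]%N).
Definition E6 : 'M[int]_6 :=
  cartan (@edges 6 [:: (0,2); (2,3); (3,4); (4,5); (1,3)]%N).
Definition E8 : 'M[int]_8 :=
  cartan (@edges 8 [:: (0,2); (2,3); (3,4); (4,5); (5,6); (6,7); (1,3)]%N).
Definition U : 'M[int]_2 := \matrix_(i, j) (if i == j then 0 else 1).

Definition scale2 n (A : 'M[int]_n) : 'M[int]_n := A *+ 2.
Definition osum m n (A : 'M[int]_m) (B : 'M[int]_n) : 'M[int]_(m + n) :=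
  block_mx A 0 0 B.

Definition bR n (G : 'M[int]_n) (x y : 'rV[RR]_n) : RR :=
  (x *m map_mx intr G *m y^T) 0 0.
Definition bZ n (G : 'M[int]_n) (x y : 'rV[int]_n) : int :=
  (x *m G *m y^T) 0 0.

Definition root_vec n (G : 'M[int]_n) (v : 'rV[int]_n) : Prop :=
  bZ G v v = 2 \/
  (bZ G v v = 6 /\ forall w : 'rV[int]_n, (3 %| bZ G v w)%Z).

(* the cone of negative vectors minus all mirrors of W (reflections in roots);
   its connected components are exactly the lifts P^# of the cells P *)
Definition cone_minus_mirrors n (G : 'M[int]_n) : set 'rV[RR]_n :=
  [set x | bR G x x < 0 /\
           forall v, root_vec G v -> bR G x (map_mx intr v) != 0].

Definition lifted_cell n (G : 'M[int]_n) (P : set 'rV[RR]_n) : Prop :=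
  exists2 x, cone_minus_mirrors G x & P = connected_component (cone_minus_mirrors G) x.

Definition isometry n (G : 'M[int]_n) (g : 'M[int]_n) : Prop :=
  g *m G *m g^T = G.

Definition direct n (g : 'M[int]_n) (P : set 'rV[RR]_n) : Prop :=
  (fun x => x *m map_mx intr g) @` P = P.

Definition integral n (x : 'rV[rat]_n) : Prop :=
  exists z : 'rV[int]_n, x = map_mx intr z.
(* x in L^*  :  x . y in Z for all y in L *)
Definition in_dual n (G : 'M[int]_n) (x : 'rV[rat]_n) : Prop :=
  integral (x *m map_mx intr G).
(* g acts as -id on discr_3 L = 3-primary part of L^*/L *)
Definition Z3_reversing n (G : 'M[int]_n) (g : 'M[int]_n) : Prop :=
  forall x : 'rV[rat]_n, in_dual G x -> (exists k : nat, integral (x *+ (3 ^ k))) ->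
    integral (x *m map_mx intr g + x).

Definition achiral n (G : 'M[int]_n) : Prop :=
  exists g : 'M[int]_n, [/\ isometry G g, Z3_reversing G g &
    exists P, lifted_cell G P /\ direct g P].
Definition chiral n (G : 'M[int]_n) : Prop := ~ achiral G.

(* Main.v *)
Require Import Defs.
From HB Require Import structures.
From mathcomp Require Import all_boot all_order all_algebra.
From mathcomp Require Import all_classical all_reals all_analysis.
From mathcomp Require Import Rstruct Rstruct_topology.
From mathcomp Require Import zify ring lra.
Set Implicit Arguments. Unset Strict Implicit. Unset Printing Implicit Defensive.
Import Order.TTheory GRing.Theory Num.Theory.
Import numFieldNormedType.Exports.
Local Open Scope classical_set_scope.
Local Open Scope ring_scope.

(** Achirality.  It is enough to find an involution acting as -1 on discr_3 whose
    coinvariant lattice K is positive definite without 2- or 6-roots: a generic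
    point of the fixed subspace then lies on no mirror, so its cell is preserved.
    In all twelve cases K can be taken isomorphic to E6(2), all of whose norms are
    divisible by 4.

    Chirality of U(k) + A2 + N with N = 0, D4, E8.  Let g preserve a lifted cell
    and let x be a point of that cell.  Among the images of the isotropic vector e
    of U(k) under isometries choose the one closest to x; after conjugation it is e
    itself, and then no mirror separates e from x, hence none separates e from eg.
    If eg <> e, write it a e + b f + l with b < 0; the 2-roots
    al e + f + m separate e from eg as soon as |m - l/b|^2 < 2, and such an m exists
    because the squared covering radius of A2 + N is at most 2/3 + 1.  (For
    U(2) + A2 the admissible m are the vectors of A2 outside 2 A2, which leaves the
    single exception eg = -f, undone by the reflection exchanging e and -f.)  So g fixes
    e and acts on the affine space over e^perp / e preserving an alcove of the affine
    group of type G2 attached to A2; this alcove has no symmetries, which forces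
    g to act trivially on A2, contrary to its action on discr_3. *)

(** No wall of a cell is enumerated. Lying on the same side of every mirror as a point [x] is a
    condition that any isometry transports, whether or not it belongs to W; this is why the closest
    vector can be sought in the orbit under all isometries. It exists because only finitely many
    lattice vectors of non-positive norm have bounded product with [x].

    The alcoves of D4 do have symmetries, so rigidity has to come from A2. The summand N enters
    through its evenness, its covering radius and a determinant prime to 3, which prevents [g] from
    moving A2 into N. The condition on discr_3 constrains the translation part of [g] as well as the
    linear one: [g] acts on the A2 plane through the affine Weyl group, which is simply transitive
    on alcoves, so following a single point is enough.

    E6(2) is a natural choice for K: the discriminant of E6 is Z/3, reversed by -1, and doubling the
    form destroys the roots. *)

Local Notation rmx := (map_mx (intr : int -> RR)).
Local Notation isometry := Defs.isometry.

(** * Bilinear forms and isometries *)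

Section Forms.
Variables (n : nat) (G : 'M[int]_n).
Implicit Types (x y z : 'rV[RR]_n) (u v w : 'rV[int]_n) (g : 'M[int]_n).

Lemma bRDl x y z : bR G (x + y) z = bR G x z + bR G y z.
Proof. by rewrite /bR !mulmxDl mxE. Qed.

Lemma bRDr x y z : bR G z (x + y) = bR G z x + bR G z y.
Proof. by rewrite /bR linearD /= mulmxDr mxE. Qed.

Lemma bRZl a x y : bR G (a *: x) y = a * bR G x y.
Proof. by rewrite /bR -!scalemxAl mxE. Qed.

Lemma bRZr a x y : bR G x (a *: y) = a * bR G x y.
Proof. by rewrite /bR linearZ /= -scalemxAr mxE. Qed.

Lemma bZDl u v w : bZ G (u + v) w = bZ G u w + bZ G v w.
Proof. by rewrite /bZ !mulmxDl mxE. Qed.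

Lemma bZDr u v w : bZ G w (u + v) = bZ G w u + bZ G w v.
Proof. by rewrite /bZ linearD /= mulmxDr mxE. Qed.

Lemma bZZl a u v : bZ G (a *: u) v = a * bZ G u v.
Proof. by rewrite /bZ -!scalemxAl mxE. Qed.

Lemma bZZr a u v : bZ G u (a *: v) = a * bZ G u v.
Proof. by rewrite /bZ linearZ /= -scalemxAr mxE. Qed.

Lemma bR_rmx u v : bR G (rmx u) (rmx v) = (bZ G u v)%:~R.
Proof. by rewrite /bR /bZ map_trmx -!map_mxM mxE. Qed.

Lemma bR_isom g x y : isometry G g ->
  bR G (x *m rmx g) (y *m rmx g) = bR G x y.
Proof.
move=> gG; rewrite /bR trmx_mul -{2}gG !map_mxM map_trmx.
by rewrite !mulmxA.
Qed.

Lemma bZ_isom g u v : isometry G g -> bZ G (u *m g) (v *m g) = bZ G u v.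
Proof. by move=> gG; rewrite /bZ trmx_mul -{2}gG !mulmxA. Qed.

Lemma isom_mul g h : isometry G g -> isometry G h -> isometry G (g *m h).
Proof.
rewrite /isometry => gG hG.
by rewrite trmx_mul !mulmxA -(mulmxA g h G) -(mulmxA g (h *m G)) hG gG.
Qed.

Lemma isom_unit g : \det G != 0 -> isometry G g -> g \in unitmx.
Proof.
move=> dG /(congr1 determinant); rewrite !det_mulmx det_tr mulrAC.
rewrite -[RHS]mul1r => /(mulIf dG) dgg.
by rewrite unitmxE; apply/unitrPr; exists (\det g).
Qed.

Lemma isom_inv g : \det G != 0 -> isometry G g -> isometry G (invmx g).
Proof.
move=> dG gG; have gu := isom_unit dG gG.
rewrite /isometry -{1}gG trmx_inv !mulmxA mulVmx // mul1mx -mulmxA.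
by rewrite mulmxV ?mulmx1 // unitmx_tr.
Qed.

Lemma root_isom g v : \det G != 0 -> isometry G g -> root_vec G v ->
  root_vec G (v *m g).
Proof.
move=> dG gG; have gu := isom_unit dG gG.
case=> [v2|[v6 v3]]; [left | right]; rewrite bZ_isom //; split=> // w.
by rewrite -[w](mulmxKV gu) bZ_isom.
Qed.

Hypothesis symG : G^T = G.

Lemma bZC u v : bZ G u v = bZ G v u.
Proof.
rewrite /bZ; have -> : u *m G *m v^T = (v *m G *m u^T)^T.
  by rewrite !trmx_mul trmxK symG mulmxA.
by rewrite mxE.
Qed.

Lemma bRC x y : bR G x y = bR G y x.
Proof.
rewrite /bR; have -> : x *m rmx G *m y^T = (y *m rmx G *m x^T)^T.
  by rewrite !trmx_mul trmxK map_trmx symG mulmxA.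
by rewrite mxE.
Qed.

(** Positivity is asked only on the span of [x] and [y], so that the inequality can be used inside
    an indefinite form. *)
Lemma cauchy_schwarz x y :
  (forall a b, 0 <= bR G (a *: x + b *: y) (a *: x + b *: y)) ->
  bR G x y ^+ 2 <= bR G x x * bR G y y.
Proof.
move=> psd; have q a b : 0 <= a * a * bR G x x + 2 * a * b * bR G x y
    + b * b * bR G y y.
  rewrite (_ : _ + _ = bR G (a *: x + b *: y) (a *: x + b *: y)) //.
  by rewrite !bRDl !bRDr !bRZl !bRZr (bRC y x); ring.
move: q; set X := bR G x x; set Y := bR G y y; set B := bR G x y => q.
have X0 : 0 <= X by have := q 1 0; lra.
have Y0 : 0 <= Y by have := q 0 1; lra.
case: (ltrP 0 X) => [X1|X1].
  have := q (- B) X; rewrite (_ : _ + _ = X * (X * Y - B ^+ 2)); last by ring.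
  by rewrite pmulr_rge0 // subr_ge0.
have Xe : X = 0 by lra.
have [->|B0] := eqVneq B 0; first by rewrite expr0n /= mulr_ge0.
(* For [X = 0] the form is affine in its first parameter, which is chosen to produce the value
   -1. *)
have := q (- (Y + 1)/ (2 * B)) 1; rewrite Xe.
have -> : (- (Y + 1) / (2 * B)) * ((- (Y + 1)) / (2 * B)) * 0
  + 2 * (- (Y + 1) / (2 * B)) * 1 * B + 1 * 1 * Y = -1 by field.
by lra.
Qed.

Lemma cauchy_schwarz_psd x y : (forall z, 0 <= bR G z z) ->
  bR G x y ^+ 2 <= bR G x x * bR G y y.
Proof. by move=> psd; apply: cauchy_schwarz. Qed.

End Forms.

Section OrthogonalSum.
Variables (m n : nat) (A : 'M[int]_m) (B : 'M[int]_n).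

Lemma bR_osum x y x' y' :
  bR (osum A B) (row_mx x y) (row_mx x' y') = bR A x x' + bR B y y'.
Proof.
rewrite /bR /osum map_block_mx !map_mx0 mul_row_block !mulmx0 addr0 add0r.
by rewrite tr_row_mx mul_row_col mxE.
Qed.

Lemma bZ_osum x y x' y' :
  bZ (osum A B) (row_mx x y) (row_mx x' y') = bZ A x x' + bZ B y y'.
Proof.
rewrite /bZ /osum mul_row_block !mulmx0 addr0 add0r.
by rewrite tr_row_mx mul_row_col mxE.
Qed.

Lemma osum_sym : A^T = A -> B^T = B -> (osum A B)^T = osum A B.
Proof. by move=> sA sB; rewrite /osum tr_block_mx sA sB !trmx0. Qed.

Lemma det_osum : \det (osum A B) = \det A * \det B.
Proof. by rewrite /osum det_ublock. Qed.
End OrthogonalSum.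

Lemma cartan_sym n (e : 'I_n -> 'I_n -> bool) : (cartan e)^T = cartan e.
Proof. by apply/matrixP => i j; rewrite !mxE eq_sym orbC. Qed.

(** * Coordinates and the light cone *)

Definition row2 (R : Type) (a b : R) : 'rV[R]_2 :=
  \row_j (if j == 0 then a else b).

(* The vector with coordinates [a, b] in U(k), [s, t] in A2 and [v] in N *)
Definition mk (R : Type) n (a b s t : R) (v : 'rV[R]_n) : 'rV[R]_(2 + 2 + n) :=
  row_mx (row_mx (row2 a b) (row2 s t)) v.

Lemma row2_surj (R : Type) (x : 'rV[R]_2) : x = row2 (x 0 0) (x 0 1).
Proof.
apply/rowP => j; rewrite mxE; case: ifP => [/eqP->//|j0]; congr (x _ _).
by apply/val_inj; case: j j0 => [[|[|]]].
Qed.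

Lemma mk_surj (R : Type) n (x : 'rV[R]_(2 + 2 + n)) :
  exists a b s t v, x = mk a b s t v.
Proof.
exists (lsubmx (lsubmx x) 0 0), (lsubmx (lsubmx x) 0 1).
exists (rsubmx (lsubmx x) 0 0), (rsubmx (lsubmx x) 0 1), (rsubmx x).
by rewrite /mk -!row2_surj !hsubmxK.
Qed.

Lemma row2_inj (R : Type) (a b a' b' : R) :
  row2 a b = row2 a' b' -> a = a' /\ b = b'.
Proof. by move=> /rowP e; move: (e 0) (e 1); rewrite !mxE. Qed.

Lemma mk_inj (R : Type) n (a b s t a' b' s' t' : R) (v v' : 'rV[R]_n) :
  mk a b s t v = mk a' b' s' t' v' ->
  [/\ a = a', b = b', s = s', t = t' & v = v'].
Proof.
rewrite /mk => e; have [e1 ->] := eq_row_mx e; have [e2 e3] := eq_row_mx e1.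
by have [-> ->] := row2_inj e2; have [-> ->] := row2_inj e3.
Qed.

Lemma map_mk (R S : Type) (f : R -> S) n (a b s t : R) (v : 'rV[R]_n) :
  map_mx f (mk a b s t v) = mk (f a) (f b) (f s) (f t) (map_mx f v).
Proof.
rewrite /mk !map_row_mx; congr (row_mx (row_mx _ _) _);
  by apply/rowP => j; rewrite !mxE; case: ifP.
Qed.

Lemma mkD (R : pzRingType) n (a b s t a' b' s' t' : R) (v v' : 'rV[R]_n) :
  mk a b s t v + mk a' b' s' t' v' = mk (a + a') (b + b') (s + s') (t + t') (v + v').
Proof.
rewrite /mk !add_row_mx; congr (row_mx (row_mx _ _) _);
  by apply/rowP => j; rewrite !mxE; case: ifP.
Qed.

Lemma mkZ (R : pzRingType) n (c a b s t : R) (v : 'rV[R]_n) :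
  c *: mk a b s t v = mk (c * a) (c * b) (c * s) (c * t) (c *: v).
Proof.
rewrite /mk !scale_row_mx; congr (row_mx (row_mx _ _) _);
  by apply/rowP => j; rewrite !mxE; case: ifP.
Qed.

Lemma mk0 (R : pzRingType) n : mk 0 0 0 0 0 = 0 :> 'rV[R]_(2 + 2 + n).
Proof.
have -> : mk 0 0 0 0 0 = 0 *: mk 0 0 0 0 0 :> 'rV[R]_(2 + 2 + n).
  by rewrite mkZ !mul0r scale0r.
by rewrite scale0r.
Qed.

Lemma det2 (R : comPzRingType) (M : 'M[R]_2) :
  \det M = M 0 0 * M 1 1 - M 0 1 * M 1 0.
Proof.
rewrite (expand_det_row _ 0) !big_ord_recl big_ord0 /cofactor !det_mx11 !mxE /=.
rewrite addr0 !expr0 expr1 mul1r mulN1r mulrN.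
by congr (M _ _ * M _ _ - M _ _ * M _ _); apply/val_inj.
Qed.

Definition lat k n (N : 'M[int]_n) : 'M[int]_(2 + 2 + n) :=
  osum (osum (U *+ k) A2) N.

Lemma U_sym k : (U *+ k)^T = U *+ k.
Proof. by apply/matrixP => i j; rewrite mulmxnE !mxE mulmxnE !mxE eq_sym. Qed.

Lemma bZ_U k a b a' b' :
  bZ (U *+ k) (row2 a b) (row2 a' b') = k%:~R * (a * b' + b * a').
Proof.
rewrite /bZ !mxE big_ord_recl big_ord1 !mxE !big_ord_recl !big_ord0 !mulmxnE !mxE /=.
by rewrite -!pmulrn; ring.
Qed.

Lemma bR_U k a b a' b' :
  bR (U *+ k) (row2 a b) (row2 a' b') = k%:R * (a * b' + b * a').
Proof.
rewrite /bR !mxE big_ord_recl big_ord1 !mxE !big_ord_recl !big_ord0 !mxE !mulmxnE !mxE /=.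
by rewrite !mul0rn -!pmulrn; ring.
Qed.

Lemma bZ_A2 s t s' t' : bZ A2 (row2 s t) (row2 s' t') =
  2 * s * s' - s * t' - t * s' + 2 * t * t'.
Proof.
rewrite /bZ !mxE big_ord_recl big_ord1 !mxE !big_ord_recl !big_ord0 !mxE /edges /=.
ring.
Qed.

Lemma bR_A2 s t s' t' : bR A2 (row2 s t) (row2 s' t') =
  2 * s * s' - s * t' - t * s' + 2 * t * t'.
Proof.
rewrite /bR !mxE big_ord_recl big_ord1 !mxE !big_ord_recl !big_ord0 !mxE /edges /=.
ring.
Qed.

Section Lat.
Variables (k n : nat) (N : 'M[int]_n).
Local Notation G := (lat k N).

Lemma bZ_mk a b s t v a' b' s' t' v' : bZ G (mk a b s t v) (mk a' b' s' t' v') =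
  k%:R * (a * b' + b * a') + (2 * s * s' - s * t' - t * s' + 2 * t * t') + bZ N v v'.
Proof. by rewrite !bZ_osum bZ_U bZ_A2 pmulrn. Qed.

Lemma bR_mk a b s t v a' b' s' t' v' : bR G (mk a b s t v) (mk a' b' s' t' v') =
  k%:R * (a * b' + b * a') + (2 * s * s' - s * t' - t * s' + 2 * t * t') + bR N v v'.
Proof. by rewrite !bR_osum bR_U bR_A2. Qed.

Lemma det_lat : (0 < k)%N -> \det N != 0 -> \det G != 0.
Proof.
move=> k0 dN; rewrite !det_osum !mulf_neq0 //.
  rewrite -scaler_nat detZ mulf_neq0 //.
    by rewrite expf_neq0 // pnatr_eq0 -lt0n.
  by rewrite det2 !mxE.
by rewrite det2 !mxE.
Qed.

Hypotheses (k0 : (0 < k)%N) (symN : N^T = N).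

Lemma lat_sym : G^T = G.
Proof. by rewrite !osum_sym // ?U_sym // cartan_sym. Qed.

Hypothesis psdN : forall v, 0 <= bR N v v.

Lemma bR_mk00 s t v : 0 <= bR G (mk 0 0 s t v) (mk 0 0 s t v).
Proof. by rewrite bR_mk; have := psdN v; nra. Qed.

Lemma spacelike_cauchy s t v s' t' v' :
  bR G (mk 0 0 s t v) (mk 0 0 s' t' v') ^+ 2 <=
  bR G (mk 0 0 s t v) (mk 0 0 s t v) * bR G (mk 0 0 s' t' v') (mk 0 0 s' t' v').
Proof.
apply: cauchy_schwarz; first exact: lat_sym.
by move=> a b; rewrite !mkZ mkD !mulr0 addr0; apply: bR_mk00.
Qed.

(** The half of the cone that contains e and -f. A vector of non-positive norm has [a * b <= 0], so
    signs in the U(k) part decide and the spacelike part is left free. *)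
Definition future (x : 'rV[RR]_(2 + 2 + n)) :=
  exists a b s t v, [/\ x = mk a b s t v, 0 <= a, b <= 0 & (a, b) != (0, 0)].

Lemma natk_gt0 : 0 < k%:R :> RR. Proof. by rewrite ltr0n. Qed.

Lemma future_or x : bR G x x < 0 -> future x \/ future (- x).
Proof.
have [a [b [s [t [v ->]]]]] := mk_surj x; have kp := natk_gt0.
have e : bR G (mk a b s t v) (mk a b s t v) =
  2 * k%:R * a * b + bR G (mk 0 0 s t v) (mk 0 0 s t v).
  by rewrite !bR_mk; ring.
have := bR_mk00 s t v; rewrite e; set q := bR G _ _ => q0 lt0.
have {lt0}: a * b < 0.
  rewrite ltNge; apply/negP => ab.
  have : 0 <= k%:R * (a * b) :> RR by exact: mulr_ge0 (ltW kp) ab.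
  lra.
have [a0|a0] := leP 0 a => ab.
  left; exists a, b, s, t, v; split=> //; first by nra.
  by apply/eqP => -[a1 b1]; move: ab; rewrite a1 b1; lra.
right; exists (- a), (- b), (- s), (- t), (- v); split.
- by rewrite -scaleN1r mkZ !mulN1r scaleN1r.
- lra.
- nra.
- by apply/eqP => -[a1 b1]; lra.
Qed.

(** Reversed Cauchy-Schwarz: (p + q)^2 = (p - q)^2 + 4 p q, and 4 K^2 p q bounds the product of the
    spacelike norms. The vector [u] may be isotropic, as e is. *)
Lemma future_bR_lt0 x u : bR G x x < 0 -> future x -> future u ->
  bR G u u <= 0 -> bR G x u < 0.
Proof.
move=> xx [a [b [s [t [v [ex a0 b0 ab]]]]]] [c [d [s' [t' [v' [eu c0 d0 cd]]]]]] uu.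
have kp := natk_gt0; move: xx uu; rewrite {}ex {}eu.
have e a1 b1 s1 t1 v1 a2 b2 s2 t2 v2 : bR G (mk a1 b1 s1 t1 v1) (mk a2 b2 s2 t2 v2) =
    k%:R * (a1 * b2 + b1 * a2) + bR G (mk 0 0 s1 t1 v1) (mk 0 0 s2 t2 v2).
  by rewrite !bR_mk; ring.
rewrite (e a b s t v a b) (e c d s' t' v' c d) (e a b s t v c d).
have := spacelike_cauchy s t v s' t' v'.
have := bR_mk00 s t v; have := bR_mk00 s' t' v'.
set X := bR G _ _; set Y := bR G _ _; set B := bR G _ _ => X0 Y0 BB xx uu.
set K := k%:R in kp xx uu *.
have ab0 : 0 < a /\ b < 0.
  have [a1|a1] := eqVneq a 0; first by move: xx; rewrite a1; lra.
  have [b1|b1] := eqVneq b 0; first by move: xx; rewrite b1; lra.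
  by rewrite lt_def a1 a0 lt_neqAle b1 b0.
case: ab0 => a1 b1; set p := a * - d; set q := - b * c.
have p0 : 0 <= p by apply: mulr_ge0; lra.
have q0 : 0 <= q by apply: mulr_ge0; lra.
have pq : 0 < p + q.
  have [c1|c1] := eqVneq c 0.
    have d1 : d < 0.
      by rewrite lt_neqAle d0 andbT; apply/eqP => d1; move/eqP: cd; rewrite c1 d1.
    have : 0 < p by apply: mulr_gt0; lra.
    lra.
  have : 0 < q by apply: mulr_gt0; [lra | rewrite lt_def c1].
  lra.
have -> : K * (a * d + b * c) + B = B - K * (p + q) by rewrite /p /q; ring.
rewrite subr_lt0; have KP : 0 < K * (p + q) by exact: mulr_gt0.
have [B0|B0] := leP B 0; first exact: le_lt_trans KP.
rewrite -(ltr_pXn2r (n := 2)) ?nnegrE //; try exact: ltW.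
apply: le_lt_trans BB _.
have xE : Y < K * (a * - b) * 2 by lra.
have uE : X <= K * (c * - d) * 2 by lra.
have K2 : 0 < K * K by exact: mulr_gt0.
have K4 : 0 <= K * K * ((p - q) * (p - q)).
  by apply: mulr_ge0; [exact: ltW | rewrite -expr2 sqr_ge0].
have eq4 : (K * (p + q)) ^+ 2 =
    K * K * ((p - q) * (p - q)) + (K * (a * - b) * 2) * (K * (c * - d) * 2).
  by rewrite /p /q; ring.
have [X1|X1] := leP X 0.
  have -> : X = 0 by lra.
  by rewrite mulr0; apply: exprn_gt0.
rewrite eq4; apply: (@lt_le_trans _ _ ((K * (a * - b) * 2) * (K * (c * - d) * 2))).
  apply: (@lt_le_trans _ _ ((K * (a * - b) * 2) * X)); first by rewrite ltr_pM2r.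
  by rewrite ler_wpM2l //; lra.
by rewrite lerDr.
Qed.

Lemma bR_cone_neq0 x y : bR G x x < 0 -> bR G y y < 0 -> bR G x y != 0.
Proof.
have bNl z w : bR G (- z) w = - bR G z w by rewrite -scaleN1r bRZl mulN1r.
have bNr z w : bR G z (- w) = - bR G z w by rewrite -scaleN1r bRZr mulN1r.
move=> xx yy; have xN : bR G (- x) (- x) < 0 by rewrite bNl bNr opprK.
have yN : bR G (- y) (- y) <= 0 by rewrite bNl bNr opprK; apply: ltW.
case: (future_or xx) => fx; case: (future_or yy) => fy.
- by have := future_bR_lt0 xx fx fy (ltW yy) => /ltr0_neq0.
- by have := future_bR_lt0 xx fx fy yN; rewrite bNr oppr_lt0 => /lt0r_neq0.
- by have := future_bR_lt0 xN fx fy (ltW yy); rewrite bNl oppr_lt0 => /lt0r_neq0.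
- by have := future_bR_lt0 xN fx fy yN; rewrite bNr bNl opprK => /ltr0_neq0.
Qed.

End Lat.

(** * Finiteness *)

Lemma mk_bound (R : numDomainType) n (a b s t : R) (v : 'rV[R]_n) (B : R) :
  `|a| <= B -> `|b| <= B -> `|s| <= B -> `|t| <= B ->
  (forall j, `|v 0 j| <= B) -> forall i, `|mk a b s t v 0 i| <= B.
Proof.
move=> ha hb hs ht hv i; rewrite mxE; case: splitP => // j _.
by rewrite mxE; case: splitP => l _; rewrite mxE; case: ifP.
Qed.

(** [T] will be an infinite set of isometries, but the vectors [u h] at least as good as [u h0] lie
    in a box; encoding the box as a finite type gives the minimum. *)
Lemma exists_min_vector (T : Type) m (Q : T -> Prop) (u : T -> 'rV[int]_m)
    (phi : 'rV[int]_m -> RR) (B : nat) (h0 : T) :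
  Q h0 ->
  (forall h, Q h -> phi (u h) <= phi (u h0) -> forall i, `|u h 0 i| <= B%:R) ->
  exists2 h, Q h & forall h', Q h' -> phi (u h) <= phi (u h').
Proof.
move=> Qh0 bnd.
pose dec (w : {ffun 'I_m -> 'I_(B + B).+1}) : 'rV[int]_m :=
  \row_i ((w i : nat)%:Z - B%:Z).
pose enc (v : 'rV[int]_m) : {ffun 'I_m -> 'I_(B + B).+1} :=
  [ffun i => inord (absz (v 0 i + B%:Z))].
have encK (v : 'rV[int]_m) : (forall i, `|v 0 i| <= B%:R) -> dec (enc v) = v.
  move=> vB; apply/rowP => i; rewrite mxE ffunE inordK; have := vB i.
    by move: (v 0 i) => z; rewrite natz; lia.
  by move: (v 0 i) => z; rewrite natz; lia.
pose P w := `[< exists2 h, Q h & u h = dec w >].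
have P0 : P (enc (u h0)) by apply/asboolP; exists h0 => //; rewrite encK //; exact: bnd.
have [w /asboolP[h Qh hw] wmin] := Order.TotalTheory.arg_minP (fun w => phi (dec w)) P0.
exists h => // h' Qh'.
have [le0|lt0] := leP (phi (u h')) (phi (u h0)).
  rewrite hw -(encK (u h')); last exact: bnd.
  apply: wmin; apply/asboolP; exists h' => //.
  by rewrite encK //; exact: bnd.
rewrite (le_trans _ (ltW lt0)) // hw -(encK (u h0)); last exact: bnd.
exact: wmin.
Qed.

Section Definite.
Variables (n : nat) (N S : 'M[int]_n) (c0 : int).
Hypothesis symN : N^T = N.
Hypothesis psdN : forall v, 0 <= bR N v v.
Hypotheses (NS : N *m S = c0%:M) (c0_neq0 : c0 != 0).

(** The rows of [S^T] are [c0] times the dual basis: pairing with them extracts the coordinates,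
    which Cauchy-Schwarz then bounds. *)
Lemma definite_coord_bound (D : RR) : exists E : RR, forall v : 'rV[RR]_n,
  bR N v v <= D -> forall j, `|v 0 j| <= E.
Proof.
pose w j := rmx (row j S^T).
have wE (v : 'rV_n) j : bR N v (w j) = c0%:~R * v 0 j.
  rewrite /bR; transitivity ((v *m rmx N *m rmx S) 0 j).
    by rewrite !mxE; apply: eq_bigr => i _; rewrite !mxE.
  rewrite -mulmxA -map_mxM NS map_scalar_mx mul_mx_scalar !mxE; ring.
pose F := \sum_j bR N (w j) (w j).
have Fj j : bR N (w j) (w j) <= F.
  by rewrite /F (bigD1 j) //= lerDl sumr_ge0.
(* [t ^+ 2 <= s] implies [t <= 1 + s], which spares a square root. *)
exists (1 + D * F) => v vD j.
have F0 : 0 <= F by apply: sumr_ge0.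
have D0 : 0 <= D by apply: le_trans (psdN v) vD.
have DF : 0 <= D * F by exact: mulr_ge0.
have := cauchy_schwarz_psd symN v (w j) psdN; rewrite wE exprMn => cs.
have c1 : 1 <= c0%:~R ^+ 2 :> RR.
  by rewrite -rmorphXn /= ler1z; move: c0_neq0; lia.
have v2 : `|v 0 j| ^+ 2 <= D * F.
  rewrite real_normK ?num_real //; apply: le_trans (_ : _ <= c0%:~R ^+ 2 * v 0 j ^+ 2) _.
    by rewrite ler_peMl ?sqr_ge0.
  apply: le_trans cs _; apply: ler_pM => //.
by have := normr_ge0 (v 0 j); nra.
Qed.

End Definite.

Section Bounds.
Variables (k n : nat) (N S : 'M[int]_n) (c0 : int).
Hypotheses (k0 : (0 < k)%N) (symN : N^T = N).
Hypothesis psdN : forall v, 0 <= bR N v v.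
Hypotheses (NS : N *m S = c0%:M) (c0_neq0 : c0 != 0).
Local Notation G := (lat k N).

(** The ratio [th < 1] of the spacelike to the hyperbolic part of [x] measures how far [x] is inside
    the cone. By Cauchy-Schwarz the spacelike part [B] of the product with [u] is at most sqrt(th)
    times its hyperbolic part [w], so bounding [w + B] bounds [w], then the U(k) coordinates of [u],
    then its spacelike norm. *)
Lemma cone_bound (x : 'rV[RR]_(2 + 2 + n)) (C : RR) : bR G x x < 0 ->
  exists B : nat, forall u : 'rV[int]_(2 + 2 + n), bZ G u u <= 0 ->
  `|bR G x (rmx u)| <= C -> forall i, `|u 0 i| <= B%:R.
Proof.
have [a [b [s [t [v ->]]]]] := mk_surj x.
have kp : 0 < k%:R :> RR by rewrite ltr0n.
set K : RR := k%:R in kp *.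
have e a1 b1 s1 t1 v1 a2 b2 s2 t2 v2 : bR G (mk a1 b1 s1 t1 v1) (mk a2 b2 s2 t2 v2) =
    K * (a1 * b2 + b1 * a2) + bR G (mk 0 0 s1 t1 v1) (mk 0 0 s2 t2 v2).
  by rewrite !bR_mk /K; ring.
rewrite (e a b s t v a b); have := bR_mk00 k psdN s t v.
set X := bR G _ _ => X0 xx.
have ab : 0 < - (K * a * b) * 2 by lra.
pose th := X / (- (K * a * b) * 2).
have th1 : th < 1 by rewrite /th ltr_pdivrMr // mul1r; lra.
have th0 : 0 <= th by apply: divr_ge0 => //; exact: ltW.
have thE : X = th * (- (K * a * b) * 2) by rewrite /th divfK // gt_eqF.
pose D := C / ((1 - th) / 2).
pose A := `|a| * K; pose B' := `|b| * K.
have a0 : a != 0 by apply/eqP => h; move: ab; rewrite h; lra.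
have b0 : b != 0 by apply/eqP => h; move: ab; rewrite h; lra.
have A0 : 0 < A by rewrite mulr_gt0 ?normr_gt0.
have B0 : 0 < B' by rewrite mulr_gt0 ?normr_gt0.
pose D2 := 2 * K * (D / A) * (D / B').
have [E vE] := definite_coord_bound symN psdN NS c0_neq0 D2.
exists (Num.bound (`|E| + D / A + D / B' + (1 + D2))) => u uu xu.
suff h i : `|rmx u 0 i| <= `|E| + D / A + D / B' + (1 + D2).
  move=> i; have M0 := le_trans (normr_ge0 _) (h i).
  have := le_lt_trans (h i) (archi_boundP M0).
  by rewrite mxE -intr_norm pmulrn ltr_int natz => /ltW.
have {uu} : bR G (rmx u) (rmx u) <= 0 by rewrite bR_rmx lerz0.
move: xu; have [c [d [s' [t' [v' ->]]]]] := mk_surj (rmx u).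
rewrite (e a b s t v c d) (e c d s' t' v' c d).
have := spacelike_cauchy k symN psdN s t v s' t' v'; rewrite -/X.
have := bR_mk00 k psdN s' t' v'.
have YE : bR G (mk 0 0 s' t' v') (mk 0 0 s' t' v') =
  2 * s' * s' - s' * t' - t' * s' + 2 * t' * t' + bR N v' v'.
  by rewrite bR_mk; ring.
set Y := bR G _ _ in YE *; set B := bR G _ _ => Y0 BB W uu.
have Ycd : Y <= - (K * c * d) * 2 by lra.
set w := K * (a * d + b * c) in W.
have cd0 : 0 <= - (K * c * d) * 2 by exact: le_trans Ycd.
have ww : w ^+ 2 = (K * (a * d - b * c)) ^+ 2 + (- (K * a * b) * 2) * (- (K * c * d) * 2).
  by rewrite /w; ring.
have Bw : B ^+ 2 <= th * w ^+ 2.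
  apply: le_trans BB _; rewrite thE -mulrA ler_wpM2l // ww.
  apply: le_trans (_ : _ <= (- (K * a * b) * 2) * (- (K * c * d) * 2)) _.
    by rewrite ler_pM2l.
  by rewrite lerDr sqr_ge0.
(* The arithmetic mean of 1 and [th] replaces their geometric mean sqrt(th). *)
have Bw' : `|B| <= (1 + th) / 2 * `|w|.
  rewrite -(ler_pXn2r (n := 2)) ?nnegrE //; last first.
    by rewrite mulr_ge0 //; lra.
  rewrite exprMn !real_normK ?num_real //; apply: le_trans Bw _.
  rewrite ler_wpM2r ?sqr_ge0 //.
  have -> : ((1 + th) / 2) ^+ 2 = th + ((1 - th) / 2) ^+ 2 by field.
  by rewrite lerDl sqr_ge0.
have wD : `|w| <= D.
  rewrite /D ler_pdivlMr; last by lra.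
  have : `|w| <= `|w + B| + `|B| by rewrite -{1}(addrK B w) ler_normB.
  lra.
have D0 : 0 <= D by exact: le_trans wD.
(* [a * d] and [b * c] have the same sign, so nothing cancels in [w], which therefore bounds [c] and
   [d] separately. *)
have adbc : 0 <= (a * d) * (b * c).
  have : 0 <= (- (K * a * b) * 2) * (- (K * c * d) * 2) by apply: mulr_ge0 => //; exact: ltW.
  have -> : - (K * a * b) * 2 * (- (K * c * d) * 2) = (4 * K * K) * (a * d * (b * c)) by ring.
  by rewrite pmulr_rge0 // !mulr_gt0.
have same (p q : RR) : 0 <= p * q -> `|p + q| = `|p| + `|q|.
  move=> pq; have [p0|p0|->] := ltgtP p 0; last by rewrite add0r normr0 add0r.
    by rewrite !ler0_norm; nra.
  by rewrite !ger0_norm; nra.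
have {same} wE : `|w| = A * `|d| + B' * `|c|.
  rewrite /w /A /B' normrM (gtr0_norm kp) same // !normrM; ring.
have dA : `|d| <= D / A.
  rewrite ler_pdivlMr // mulrC; apply: le_trans wD; rewrite wE lerDl mulr_ge0 //; exact: ltW.
have cB : `|c| <= D / B'.
  rewrite ler_pdivlMr // mulrC; apply: le_trans wD; rewrite wE lerDr mulr_ge0 //; exact: ltW.
have YD : Y <= D2.
  apply: le_trans Ycd _; rewrite /D2.
  have -> : - (K * c * d) * 2 = 2 * K * - (d * c) by ring.
  rewrite -[leRHS](mulrA (2 * K)) ler_wpM2l //; first by lra.
  apply: le_trans (ler_norm _) _; rewrite normrN normrM; exact: ler_pM.
have N0 := psdN v'.
have D20 : 0 <= D2 by exact: le_trans YD.
have sD : `|s'| <= 1 + D2.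
  have : `|s'| ^+ 2 <= D2 by rewrite real_normK ?num_real //; nra.
  by have := normr_ge0 s'; nra.
have tD : `|t'| <= 1 + D2.
  have : `|t'| ^+ 2 <= D2 by rewrite real_normK ?num_real //; nra.
  by have := normr_ge0 t'; nra.
have vD := vE v'.
have DA0 : 0 <= D / A by exact: le_trans dA.
have DB0 : 0 <= D / B' by exact: le_trans cB.
have E0 := normr_ge0 E.
apply: mk_bound; try lra.
move=> j; have := vD _ j; have := ler_norm E => EE h.
have /h : bR N v' v' <= D2 by nra.
lra.
Qed.

End Bounds.

(** * Cells *)

Lemma continuous_linear_form (R : realType) m (c : 'cV[R]_m) :
  continuous (fun x : 'rV[R]_m => (x *m c) 0 0).
Proof.
have -> : (fun x : 'rV[R]_m => (x *m c) 0 0) = (fun x => \sum_i x 0 i * c i 0).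
  by apply/funext => x; rewrite mxE.
elim: (index_enum _) => [|i r IHr].
  have -> : (fun x : 'rV[R]_m => \sum_(j <- [::]) x 0 j * c j 0) = fun=> 0.
    by apply/funext => y; rewrite big_nil.
  by move=> x; apply: cst_continuous.
have -> : (fun x : 'rV[R]_m => \sum_(j <- i :: r) x 0 j * c j 0) =
    fun x => x 0 i * c i 0 + \sum_(j <- r) x 0 j * c j 0.
  by apply/funext => y; rewrite big_cons.
move=> x; apply: (@continuousD _ R^o _ (fun y : 'rV[R]_m => y 0 i * c i 0)
  (fun y => \sum_(j <- r) y 0 j * c j 0)); last exact: IHr.
by apply: continuousM; [exact: coord_continuous | exact: cst_continuous].
Qed.

Lemma continuous_bR m (G : 'M[int]_m) y : continuous (bR G ^~ y).
Proof.
have -> : bR G ^~ y = (fun x => (x *m (rmx G *m y^T)) 0 0).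
  by apply/funext => x; rewrite /bR mulmxA.
exact: continuous_linear_form.
Qed.

Lemma continuous_mulmxr (R : realType) m p (M : 'M[R]_(m, p)) :
  continuous (fun x : 'rV[R]_m => x *m M).
Proof.
move=> x A [P Pnbhs PA]; have Fx := nbhs_filter x.
have near j : nbhs x (fun y => P 0 j ((y *m M) 0 j)).
  have E (z : 'rV[R]_m) : (z *m M) 0 j = (z *m col j M) 0 0.
    by rewrite !mxE; apply: eq_bigr => i _; rewrite !mxE.
  have := Pnbhs 0 j; rewrite /= E => /(continuous_linear_form (c := col j M)).
  by apply: (@filterS _ _ Fx) => y /=; rewrite -E.
apply: (@filterS _ _ Fx _ _ _ (@filter_forall _ _ _ _ Fx near)) => y Py.
by apply: PA => i j; rewrite ord1; exact: Py.
Qed.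

Lemma connected_same_sign (R : realType) (T : topologicalType) (P : set T)
    (f : T -> R) x y :
  connected P -> continuous f -> (forall z, P z -> f z != 0) -> P x -> P y ->
  0 < f x * f y.
Proof.
move=> cP cf f0 Px Py.
have /connected_intervalP I : connected (f @` P).
  by apply: connected_continuous_connected cP _; exact: continuous_subspaceT.
have fx : (f @` P) (f x) by exists x.
have fy : (f @` P) (f y) by exists y.
have no a b : (f @` P) a -> (f @` P) b -> a < 0 -> 0 < b -> False.
  move=> Pa Pb a0 b0; have [|z Pz z0] := I a b Pa Pb 0; first by rewrite !ltW.
  by have := f0 z Pz; rewrite z0 eqxx.
case: (ltgtP (f x) 0) (f0 _ Px) => // xs _; case: (ltgtP (f y) 0) (f0 _ Py) => // ys _.
- by rewrite nmulr_rgt0.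
- by case: (no (f x) (f y)).
- by case: (no (f y) (f x)).
- exact: mulr_gt0.
Qed.

(* The only consequences of directness that the chirality argument uses: the
   images of an interior point of the cell lie on the same side of all mirrors
   and in the same half of the cone. *)
Definition cell_preserving m (G g : 'M[int]_m) (x : 'rV[RR]_m) :=
  [/\ bR G x x < 0,
      forall r, root_vec G r -> 0 < bR G x (rmx r) * bR G (x *m rmx g) (rmx r)
    & bR G x (x *m rmx g) < 0].

Section Conjugation.
Variables (m : nat) (G : 'M[int]_m).
Hypotheses (symG : G^T = G) (detG : \det G != 0).

Lemma direct_cell_preserving g :
  (forall x y, bR G x x < 0 -> bR G y y < 0 -> bR G x y != 0) ->
  (exists P, lifted_cell G P /\ direct g P) -> exists x, cell_preserving G g x.
Proof.
move=> cone0 [P [[x xA ->] dP]]; exists x.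
set A := cone_minus_mirrors G in xA dP *.
have Px : connected_component A x x by exact: connected_component_refl.
have Pxg : connected_component A x (x *m rmx g) by rewrite -dP; exists x.
have cP : connected (connected_component A x) by exact: component_connected.
have sub := @connected_component_sub _ A x.
case: (xA) => xx xr; split=> // [r rr|].
  apply: (connected_same_sign cP (continuous_bR (y := rmx r))) => // z /sub[_]; exact.
have := connected_same_sign cP (continuous_bR (G := G) (y := x)) _ Px Pxg.
rewrite (bRC symG (x *m _)) nmulr_rgt0 //; apply=> z /sub[zz _]; exact: cone0.
Qed.

Lemma cell_preserving_conj g h x : isometry G h -> cell_preserving G g x ->
  cell_preserving G (h *m g *m invmx h) (x *m rmx (invmx h)).
Proof.
move=> hG [xx xr xg]; have hu := isom_unit detG hG; have hi := isom_inv detG hG.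
have E : x *m rmx (invmx h) *m rmx (h *m g *m invmx h) = x *m rmx g *m rmx (invmx h).
  by rewrite !map_mxM !mulmxA -(mulmxA x) -map_mxM mulVmx // map_mx1 mulmx1.
split=> [|r rr|]; rewrite ?E; try by rewrite bR_isom.
rewrite -[r](mulmxK hu).
by rewrite map_mxM !bR_isom // xr //; exact: root_isom.
Qed.

Lemma Z3_reversing_conj g h : isometry G h -> Z3_reversing G g ->
  Z3_reversing G (h *m g *m invmx h).
Proof.
move=> hG rg x [z xz] [l [y xy]]; have hu := isom_unit detG hG.
pose q := (map_mx intr : 'M[int]_m -> 'M[rat]_m).
have hq : q h *m q (invmx h) = 1%:M by rewrite -map_mxM mulmxV // map_mx1.
have [||w wE] := rg (x *m q h).
- exists (z *m (invmx h)^T).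
  rewrite map_mxM -xz -!mulmxA -!map_mxM; congr (_ *m map_mx _ _).
  by rewrite -{2}hG -!mulmxA -trmx_mul mulVmx // trmx1 mulmx1.
- by exists l, (y *m h); rewrite -scaler_nat scalemxAl scaler_nat xy map_mxM.
exists (w *m invmx h); rewrite !map_mxM -wE mulmxDl -!mulmxA.
by rewrite -/(q h) -/(q _) -/(q g) hq mulmx1.
Qed.

End Conjugation.

(** * Chirality *)

Section Reflections.
Variables (m : nat) (G : 'M[int]_m).
Hypothesis symG : G^T = G.

Lemma isometry_of_bZ (h : 'M[int]_m) :
  (forall u v, bZ G (u *m h) (v *m h) = bZ G u v) -> isometry G h.
Proof.
have E (M : 'M[int]_m) i j :
    (delta_mx (0 : 'I_1) i *m M *m (delta_mx (0 : 'I_1) j)^T) 0 0 = M i j.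
  by rewrite trmx_delta -rowE -colE !mxE.
move=> hG; apply/matrixP => i j; rewrite -E -[RHS]E.
by have := hG (delta_mx 0 i) (delta_mx 0 j); rewrite /bZ trmx_mul !mulmxA.
Qed.

Lemma root_norm_gt0 r : root_vec G r -> 0 < bZ G r r.
Proof. by case=> [->|[-> _]]. Qed.

(** The coefficient 2 (v, r) / (r, r) is an integer: for a 6-root this is what the divisibility of
    (v, r) by 3 provides. *)
Lemma root_reflection r : root_vec G r ->
  exists (h : 'M[int]_m) (c : 'rV[int]_m -> int), [/\ isometry G h,
    forall v, v *m h = v - c v *: r
    & forall v, c v * bZ G r r = 2 * bZ G v r].
Proof.
move=> rr; have [w wE] : exists w : 'cV[int]_m, bZ G r r *: w = 2 *: (G *m r^T).
  case: rr => [->|[-> r3]]; first by exists (G *m r^T).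
  exists (\col_i divz ((G *m r^T) i 0) 3).
  apply/colP => i; have := r3 (delta_mx 0 i).
  rewrite (bZC symG) /bZ -mulmxA -rowE mxE.
  move=> /dvdzP[y zy]; rewrite mxE [X in _ * X]mxE [RHS]mxE zy mulzK //; ring.
pose c (v : 'rV[int]_m) := (v *m w) 0 0.
have hE (v : 'rV[int]_m) : v *m (1%:M - w *m r) = v - c v *: r.
  by rewrite mulmxBr mulmx1 mulmxA [v *m w]mx11_scalar mul_scalar_mx.
have cE v : c v * bZ G r r = 2 * bZ G v r.
  have := congr1 (fun M : 'cV[int]_m => (v *m M) 0 0) wE.
  by rewrite -!scalemxAr mxE [in RHS]mxE /bZ mulmxA mulrC.
exists (1%:M - w *m r), c; split=> //; apply: isometry_of_bZ => u v.
rewrite !hE.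
have bB a b : bZ G (a - b) = bZ G a \- bZ G b.
  by apply/funext => z; rewrite /= -scaleN1r bZDl bZZl mulN1r.
have bBr z a b : bZ G z (a - b) = bZ G z a - bZ G z b.
  by rewrite -scaleN1r bZDr bZZr mulN1r.
rewrite !bBr !bB /= !bZZl !bZZr (bZC symG r v).
have := cE u; have := cE v; have := root_norm_gt0 rr.
move: (c u) (c v) (bZ G u r) (bZ G v r) (bZ G r r) => cu cv ur vr q q0 e1 e2.
have : cv * (cu * q) = cv * (2 * ur) by rewrite e2.
have : cu * (cv * q) = cu * (2 * vr) by rewrite e1.
by lia.
Qed.

End Reflections.


Lemma mkB (R : pzRingType) n (a b s t a' b' s' t' : R) (v v' : 'rV[R]_n) :
  mk a b s t v - mk a' b' s' t' v' = mk (a - a') (b - b') (s - s') (t - t') (v - v').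
Proof. by rewrite -scaleN1r mkZ mkD !mulN1r scaleN1r. Qed.

(** * Automorphisms of A2, its alcove and its covering radius *)

Lemma A2_form_gt0 (l1 l2 : int) :
  (0 <= l1 * l1 - l1 * l2 + l2 * l2) /\
  (l1 * l1 - l1 * l2 + l2 * l2 = 0 -> l1 = 0 /\ l2 = 0).
Proof. by split=> [|h]; [nia | split; nia]. Qed.

Lemma A2_roots (a b : int) : a * a - a * b + b * b = 1 ->
  (a = 1 /\ b = 0) \/ (a = -1 /\ b = 0) \/ (a = 0 /\ b = 1) \/
  (a = 0 /\ b = -1) \/ (a = 1 /\ b = 1) \/ (a = -1 /\ b = -1).
Proof.
move=> h; have ha : -1 <= a <= 1 by nia.
have hb : -1 <= b <= 1 by nia.
have : (a = -1 \/ a = 0 \/ a = 1) by lia.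
have : (b = -1 \/ b = 0 \/ b = 1) by lia.
by move=> [hb'|[hb'|hb']] [ha'|[ha'|ha']]; subst; lia.
Qed.

(** The congruences say that a1 - a2 goes to its opposite modulo 3. Among the twelve automorphisms
    of A2 they select the coset -W(A2), hence six cases. *)
Lemma A2_reversing (a b c d : int) : a * a - a * b + b * b = 1 ->
  c * c - c * d + d * d = 1 -> 2 * a * c - a * d - b * c + 2 * b * d = -1 ->
  (3 %| a - c + 1)%Z -> (3 %| b - d - 1)%Z ->
  [\/ [/\ a = 1, b = 0, c = -1 & d = -1], [/\ a = 0, b = 1, c = 1 & d = 0],
      [/\ a = 1, b = 1, c = -1 & d = 0] | [\/ [/\ a = -1, b = 0, c = 0 & d = -1],
      [/\ a = 0, b = -1, c = 1 & d = 1] | [/\ a = -1, b = -1, c = 0 & d = 1]]].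
Proof.
move=> n1 n2 + /dvdzP[p pE] /dvdzP[q qE].
have [[h1 h2]|[[h1 h2]|[[h1 h2]|[[h1 h2]|[[h1 h2]|[h1 h2]]]]]] := A2_roots n1;
have [[h3 h4]|[[h3 h4]|[[h3 h4]|[[h3 h4]|[[h3 h4]|[h3 h4]]]]]] := A2_roots n2;
subst a b c d => n12; try (exfalso; lia).
all: by [apply: Or41 | apply: Or42 | apply: Or43
  | apply: Or44; apply: Or31 | apply: Or44; apply: Or32 | apply: Or44; apply: Or33].
Qed.

(** [b1], [b2], [e] are the values of a1, a2, e at a point of the alcove, a triangle with angles
    pi/2, pi/3, pi/6. The congruence [c1 = c2] modulo 3 puts the translation part in A2, so the map
    lies in the affine Weyl group. Sending a point of the alcove into the alcove, it would be the
    identity, whose linear part is not in -W(A2). *)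
Lemma alcove_rigid (c1 c2 m11 m12 m21 m22 : int) (b1 b2 e : RR) :
  m11 * m11 - m11 * m12 + m12 * m12 = 1 -> m21 * m21 - m21 * m22 + m22 * m22 = 1 ->
  2 * m11 * m21 - m11 * m22 - m12 * m21 + 2 * m12 * m22 = -1 ->
  (3 %| c1 - c2)%Z -> (3 %| m11 - m21 + 1)%Z -> (3 %| m12 - m22 - 1)%Z ->
  0 < b2 -> b2 < b1 -> b1 + b2 < - e ->
  let a1 := c1%:~R * e + m11%:~R * b1 + m12%:~R * b2 in
  let a2 := c2%:~R * e + m21%:~R * b1 + m22%:~R * b2 in
  0 < a2 -> a2 < a1 -> a1 + a2 < - e -> False.
Proof.
move=> n1 n2 n12 d0 d1 d2.
(* [p] is the new value and [p - c%:~R * e] that of a root of A2 at the old point; their ranges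
   leave [c = 0] or [c = -1]. For [c1] and [c2] the congruence modulo 3 then gives [c1 = c2]. *)
have bd (c : int) (p : RR) : 0 < - e -> 0 < p < - e -> e < p - c%:~R * e < - e ->
    c = 0 \/ c = -1.
  move=> e0 /andP[h1 h2] /andP[h3 h4].
  have l1 : c < 1.
    rewrite ltNge -(ler_int RR); apply/negP => h.
    have : 0 <= (c%:~R - 1) * (- e) by apply: mulr_ge0; lra.
    lra.
  have l2 : -2 < c.
    rewrite ltNge -(ler_int RR); apply/negP => h.
    have : 0 <= (- 2 - c%:~R) * (- e) by apply: mulr_ge0; lra.
    lra.
  by lia.
move=> y1 y2 y3 /= x1 x2 x3.
have e0 : 0 < - e by lra.
have c1E p : p = c1%:~R * e + m11%:~R * b1 + m12%:~R * b2 -> e < p - c1%:~R * e < - e ->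
    c1 = 0 \/ c1 = -1.
  by move=> pE; apply: bd => //; rewrite pE; apply/andP; split; lra.
have c2E p : p = c2%:~R * e + m21%:~R * b1 + m22%:~R * b2 -> e < p - c2%:~R * e < - e ->
    c2 = 0 \/ c2 = -1.
  by move=> pE; apply: bd => //; rewrite pE; apply/andP; split; lra.
have {c1E} := c1E _ erefl; have {c2E} := c2E _ erefl; move: x1 x2 x3.
have [[-> -> -> ->]|[-> -> -> ->]|[-> -> -> ->]|[[-> -> -> ->]|[-> -> -> ->]|[-> -> -> ->]]]
  := A2_reversing n1 n2 n12 d1 d2.
all: rewrite ?mulr0z ?mulr1z ?mulrN1z => x1 x2 x3 H2 H1.
all: have [|h2|h2] := H2; first by apply/andP; split; lra.
all: have [|h1|h1] := H1; first by apply/andP; split; lra.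
all: move: d0; rewrite {}h1 {}h2 // in x1 x2 x3 * => _.
all: by move: x1 x2 x3; rewrite ?mulr0z ?mulrN1z; lra.
Qed.

Lemma frac_part (y : RR) : exists (m : int) (u : RR), y = m%:~R + u /\ 0 <= u < 1.
Proof.
exists (Num.floor y), (y - (Num.floor y)%:~R); split; first by lra.
by have := floor_itv y; rewrite intrD => /andP[]; lra.
Qed.

(* The unit cell is cut into two equilateral triangles; a point with largest
   barycentric coordinate at a vertex is within 2/3 of an edge length of it. *)
Lemma A2_cover (y1 y2 : RR) : exists m1 m2 : int,
  let u := y1 - m1%:~R in let v := y2 - m2%:~R in u * u - u * v + v * v < 1 / 2.
Proof.
have [n1 [u [-> /andP[u0 u1]]]] := frac_part y1.
have [n2 [v [-> /andP[v0 v1]]]] := frac_part y2.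
have near (i j : int) : (u - i%:~R) * (u - i%:~R) - (u - i%:~R) * (v - j%:~R) +
    (v - j%:~R) * (v - j%:~R) < 1 / 2 -> exists m1 m2 : int,
  let u' := n1%:~R + u - m1%:~R in let v' := n2%:~R + v - m2%:~R in
  u' * u' - u' * v' + v' * v' < 1 / 2.
  move=> h; exists (n1 + i), (n2 + j) => /=; rewrite !intrD.
  by rewrite !opprD !addrA ![_ + _ - n1%:~R]addrAC ![_ + _ - n2%:~R]addrAC !subrr !add0r.
have [vu|uv] := leP v u.
  have [h|h] := leP (1 / 3) (1 - u); first by apply: (near 0 0); nra.
  have [h'|h'] := leP (1 / 3) (u - v); first by apply: (near 1 0); nra.
  by apply: (near 1 1); nra.
have [h|h] := leP (1 / 3) (1 - v); first by apply: (near 0 0); nra.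
have [h'|h'] := leP (1 / 3) (v - u); first by apply: (near 0 1); nra.
by apply: (near 1 1); nra.
Qed.

(** A point of an equilateral triangle is closer to a given vertex than the side length unless it is
    another vertex. Every triangle of A2 has vertices outside 2 A2, and the choice made here fails
    only at points of 2 A2. The form is half the norm. *)
Lemma A2_cover_odd (y1 y2 : RR) :
  (exists m1 m2 : int, ~~ ((2 %| m1)%Z && (2 %| m2)%Z) /\
    let u := y1 - m1%:~R in let v := y2 - m2%:~R in u * u - u * v + v * v < 1) \/
  (exists h1 h2 : int, y1 = 2 * h1%:~R /\ y2 = 2 * h2%:~R).
Proof.
have [n1 [u [-> /andP[u0 u1]]]] := frac_part y1.
have [n2 [v [-> /andP[v0 v1]]]] := frac_part y2.
have [ev|od] := boolP ((2 %| n1)%Z && (2 %| n2)%Z); last first.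
  left; exists n1, n2; split=> //=; rewrite !(addrC n1%:~R, addrC n2%:~R) !addrK.
  by have [vu|uv] := leP v u; nra.
have {ev} [/dvdzP[h1 e1] /dvdzP[h2 e2]] := andP ev.
have [[uz vz]|nz] : (u = 0 /\ v = 0) \/ 0 < u + v.
  have [p|p] := leP (u + v) 0; [left|by right].
  by split; lra.
  right; exists h1, h2; rewrite uz vz e1 e2 !intrM; split; ring.
left; have [vu|uv] := leP v u.
  exists (n1 + 1), n2; rewrite e1 e2; split; first by apply/negP => /andP[+ _]; lia.
  by move=> /=; rewrite !intrD; move: (h1 * 2)%:~R (h2 * 2)%:~R => a b; nra.
exists n1, (n2 + 1); rewrite e1 e2; split; first by apply/negP => /andP[_ +]; lia.
by move=> /=; rewrite !intrD; move: (h1 * 2)%:~R (h2 * 2)%:~R => a b; nra.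
Qed.

Section Chirality.
Variables (k n : nat) (N S : 'M[int]_n) (c0 : int).
Hypotheses (k0 : (0 < k)%N) (symN : N^T = N).
Hypothesis psdN : forall v, 0 <= bR N v v.
Hypotheses (NS : N *m S = c0%:M) (c03 : ~~ (3 %| c0)%Z).
Hypothesis evenN : forall v : 'rV[int]_n, (2 %| bZ N v v)%Z.
Local Notation G := (lat k N).

Definition vec_e : 'rV[int]_(2 + 2 + n) := mk 1 0 0 0 0.
(* A timelike vector whose projection lies in the chosen alcove of A2: it meets
   a2, a1 - a2 and - e - a1 - a2 positively. *)
Definition vec_rho : 'rV[int]_(2 + 2 + n) := mk 2 (- 8) 4 3 0.

Lemma rmx_mk a b s t v : rmx (mk a b s t v) =
  mk a%:~R b%:~R s%:~R t%:~R (rmx v) :> 'rV[RR]_(2 + 2 + n).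
Proof. exact: map_mk. Qed.

Lemma c0_neq0 : c0 != 0.
Proof. by apply/eqP => h; move: c03; rewrite h dvdz0. Qed.
Lemma detN : \det N != 0.
Proof.
have := congr1 determinant NS; rewrite det_mulmx det_scalar => e.
apply/eqP => d0; move: e; rewrite d0 mul0r => /esym/eqP.
by rewrite expf_eq0 (negPf c0_neq0) andbF.
Qed.

Lemma detG : \det G != 0. Proof. exact: det_lat detN. Qed.
Lemma symG : G^T = G. Proof. exact: lat_sym. Qed.

Lemma future_e : future (rmx vec_e).
Proof.
rewrite rmx_mk; exists 1, 0, 0, 0, (rmx 0); split=> //.
by apply/eqP => -[/eqP]; rewrite oner_eq0.
Qed.

Lemma bZ_mk_rmx0 (v : 'rV[int]_n) : bZ N v 0 = 0 /\ bZ N 0 v = 0.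
Proof. by rewrite /bZ trmx0 mulmx0 !mul0mx !mxE. Qed.

Lemma bZ_ee : bZ G vec_e vec_e = 0.
Proof. by rewrite bZ_mk (bZ_mk_rmx0 0).1; ring. Qed.

Lemma bRN x y : bR G (- x) y = - bR G x y.
Proof. by rewrite -scaleN1r bRZl mulN1r. Qed.

Lemma bRNr x y : bR G x (- y) = - bR G x y.
Proof. by rewrite -scaleN1r bRZr mulN1r. Qed.

Lemma future_of_lt0 x u : bR G x x < 0 -> bR G u u <= 0 -> future u ->
  bR G x u < 0 -> future x.
Proof.
move=> xx uu fu xu; case: (future_or k0 psdN xx) => // fx.
have := future_bR_lt0 k0 symN psdN _ fx fu uu.
by rewrite bRN bRNr bRN opprK => /(_ xx); lra.
Qed.

(** The left side is the product of [u] with the reflection of [x] in [r], which stays in the same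
    half of the cone. Thus a reflected e remains a competitor in the search for the closest
    vector. *)
Lemma future_reflection x u r : bR G x x < 0 -> future x ->
  future u -> bR G u u <= 0 -> 0 < bR G r r ->
  bR G x u - 2 * bR G x r * bR G r u / bR G r r < 0.
Proof.
move=> xx fx fu uu rr; set q := bR G r r in rr *.
pose y := x - (2 * bR G x r / q) *: r.
have xy : bR G x y < 0.
  rewrite /y bRDr bRNr bRZr.
  have : 0 <= 2 * (bR G x r ^+ 2 / q).
    by rewrite mulr_ge0 // divr_ge0 ?sqr_ge0 // ltW.
  have -> : 2 * bR G x r / q * bR G x r = 2 * (bR G x r ^+ 2 / q) by ring.
  lra.
have yy : bR G y y < 0.
  suff -> : bR G y y = bR G x x by [].
  rewrite /y !(bRDl, bRDr, bRN, bRNr, bRZl, bRZr) (bRC symG r x) -/q.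
  by field; rewrite gt_eqF.
have fy : future y.
  by apply: future_of_lt0 yy (ltW xx) fx _; rewrite (bRC symG).
have := future_bR_lt0 k0 symN psdN yy fy fu uu.
rewrite /y bRDl bRN bRZl; set a := 2 * _ / _ * _; set b := 2 * _ * _ / _.
by have -> : a = b by rewrite /a /b; ring.
Qed.

Lemma exists_min_isometry x (e : 'rV[int]_(2 + 2 + n)) (Q : 'M[int]_(2 + 2 + n) -> Prop) h0 :
  bR G x x < 0 -> bZ G e e <= 0 -> Q h0 ->
  (forall h, Q h -> isometry G h /\ bR G x (rmx (e *m h)) < 0) ->
  exists2 h, Q h & forall h', Q h' ->
    bR G x (rmx (e *m h')) <= bR G x (rmx (e *m h)).
Proof.
move=> xx ee Qh0 Qx.
have [B Bb] := cone_bound k0 symN psdN NS c0_neq0 (- bR G x (rmx (e *m h0))) xx.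
have [|h Qh hmin] := @exists_min_vector _ _ Q (fun h => e *m h)
  (fun u => - bR G x (rmx u)) B h0 Qh0.
  move=> h /[dup] Qh /Qx[hG hx] hh; apply: Bb; first by rewrite bZ_isom.
  by rewrite ltr0_norm.
by exists h => // h' /hmin; rewrite lerN2.
Qed.

(** The inequalities are weak because [vec_rho] has no component in N and so lies on the mirrors of
    the roots of N. *)
Definition normalized g x := [/\ isometry G g, Z3_reversing G g,
  cell_preserving G g x, bR G x (rmx vec_e) < 0 &
  forall r, root_vec G r -> 0 <= (bZ G r vec_e)%:~R * bR G x (rmx r) /\
    (bZ G r vec_e = 0 -> 0 <= (bZ G r vec_rho)%:~R * bR G x (rmx r))].

(* A closest vector of the orbit of [vec_e] is not separated from [x] by any
   mirror, since reflecting it in that mirror would bring it closer; then the same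
   argument is applied to [vec_rho] and the stabiliser of [vec_e]. *)
Lemma normal_form g x : isometry G g -> Z3_reversing G g ->
  cell_preserving G g x ->
  exists g' x', normalized g' x'.
Proof.
have bRe : bR G (rmx vec_e) (rmx vec_e) <= 0 by rewrite bR_rmx bZ_ee.
move=> gG rg cg; have xx : bR G x x < 0 by case: cg.
have Emul (y : 'rV[RR]_(2 + 2 + n)) h u : isometry G h ->
    bR G (y *m rmx (invmx h)) (rmx u) = bR G y (rmx (u *m h)).
  move=> hG; have hu := isom_unit detG hG.
  by rewrite -(bR_isom _ _ hG) -mulmxA -!map_mxM mulVmx // map_mx1 mulmx1.
pose Q1 h := isometry G h /\ bR G x (rmx (vec_e *m h)) < 0.
have [h0 Qh0] : exists h, Q1 h.
  have i1 : isometry G 1%:M by rewrite /Defs.isometry trmx1 mulmx1 mul1mx.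
  have iN : isometry G (- 1%:M).
    by rewrite /Defs.isometry linearN /= trmx1 mulmxN mulmx1 mulNmx mul1mx opprK.
  case: (future_or k0 psdN xx) => fx.
    exists 1%:M; split=> //; rewrite mulmx1.
    exact (future_bR_lt0 k0 symN psdN xx fx future_e bRe).
  exists (- 1%:M); split=> //; rewrite mulmxN mulmx1 map_mxN bRNr -bRN.
  apply: (future_bR_lt0 k0 symN psdN _ fx future_e bRe).
  by rewrite bRN bRNr opprK.
have [h1 [h1G xh1] h1min] : exists2 h, Q1 h & forall h', Q1 h' ->
    bR G x (rmx (vec_e *m h')) <= bR G x (rmx (vec_e *m h)).
  by apply: exists_min_isometry Qh0 _ => //; rewrite bZ_ee.
set x1 := x *m rmx (invmx h1); set g1 := h1 *m g *m invmx h1.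
have g1G : isometry G g1.
  by apply: isom_mul; [exact: isom_mul | exact: (isom_inv detG)].
have rg1 : Z3_reversing G g1 by apply: (Z3_reversing_conj detG h1G rg).
have cg1 : cell_preserving G g1 x1 by apply: (cell_preserving_conj detG h1G cg).
have x1e : bR G x1 (rmx vec_e) < 0 by rewrite Emul.
have xx1 : bR G x1 x1 < 0 by case: cg1.
have fx1 : future x1 by exact: (future_of_lt0 xx1 bRe future_e x1e).
have r1 r : root_vec G r -> 0 <= (bZ G r vec_e)%:~R * bR G x1 (rmx r).
  move=> rr; rewrite leNgt; apply/negP => neg.
  have [s [c [sG sE cE]]] := root_reflection symG rr.
  have q0 : 0 < (bZ G r r)%:~R :> RR by rewrite ltr0z root_norm_gt0.
  have cR : (c vec_e)%:~R = 2 * (bZ G r vec_e)%:~R / (bZ G r r)%:~R :> RR.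
    apply: (mulIf (lt0r_neq0 q0)).
    by rewrite divfK ?gt_eqF // -intrM cE intrM (bZC symG).
  have E : bR G x1 (rmx (vec_e *m s)) =
      bR G x1 (rmx vec_e) - (c vec_e)%:~R * bR G x1 (rmx r).
    by rewrite sE map_mxB map_mxZ bRDr bRNr bRZr.
  have lt0 : bR G x1 (rmx (vec_e *m s)) < 0.
    have := future_reflection xx1 fx1 future_e bRe (r := rmx r).
    rewrite E cR !bR_rmx => /(_ q0); set a := _ / _; set b := _ / _.
    by have -> : a = b * bR G x1 (rmx r) by rewrite /a /b; ring.
  have := h1min (s *m h1); rewrite mulmxA -!(Emul x h1 _ h1G) -/x1 E => H.
  have : (c vec_e)%:~R * bR G x1 (rmx r) < 0.
    rewrite cR (_ : _ * _ = (2 / (bZ G r r)%:~R) *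
      ((bZ G r vec_e)%:~R * bR G x1 (rmx r))); last by ring.
    by rewrite pmulr_rlt0 // divr_gt0.
  have : Q1 (s *m h1).
    by split; [exact: isom_mul | rewrite mulmxA -(Emul x h1 _ h1G)].
  move/H; lra.
pose Q2 h := isometry G h /\ vec_e *m h = vec_e.
have rho2 : bZ G vec_rho vec_rho < 0.
  by rewrite bZ_mk (bZ_mk_rmx0 0).1; lia.
have rhoe : bZ G vec_rho vec_e < 0 by rewrite bZ_mk (bZ_mk_rmx0 0).1; lia.
have Q20 : Q2 1%:M.
  by split; [rewrite /Defs.isometry trmx1 mulmx1 mul1mx | rewrite mulmx1].
have [h2 [h2G h2e] h2min] : exists2 h, Q2 h & forall h', Q2 h' ->
    bR G x1 (rmx (vec_rho *m h')) <= bR G x1 (rmx (vec_rho *m h)).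
  apply: exists_min_isometry Q20 _ => //; first exact: ltW.
  move=> h [hG he]; split=> //.
  have rr : bR G (rmx (vec_rho *m h)) (rmx (vec_rho *m h)) < 0.
    by rewrite bR_rmx bZ_isom // ltrz0.
  apply: (future_bR_lt0 k0 symN psdN xx1 fx1 _ (ltW rr)).
  apply: (future_of_lt0 rr bRe future_e _).
  by rewrite -he bR_rmx bZ_isom // ltrz0.
set x2 := x1 *m rmx (invmx h2); set g2 := h2 *m g1 *m invmx h2.
exists g2, x2; split.
- by apply: isom_mul; [exact: isom_mul | exact: (isom_inv detG)].
- by apply: (Z3_reversing_conj detG h2G rg1).
- by apply: (cell_preserving_conj detG h2G cg1).
- by rewrite Emul // h2e.
move=> r rr; split.
  rewrite Emul // -(bZ_isom _ _ h2G) h2e; apply: r1; exact: (root_isom detG).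
move=> re; have [s [c [sG sE cE]]] := root_reflection symG rr.
have q0 := root_norm_gt0 rr.
have ce : c vec_e = 0.
  have := cE vec_e; rewrite (bZC symG) re mulr0 => /eqP; rewrite mulf_eq0 => /orP[/eqP//|/eqP q1].
  by move: q0; rewrite q1.
have := h2min (s *m h2); rewrite mulmxA -!(Emul x1 h2 _ h2G) -/x2.
rewrite sE map_mxB map_mxZ bRDr bRNr bRZr => H.
have {H} : 0 <= (c vec_rho)%:~R * bR G x2 (rmx r).
  have Q : Q2 (s *m h2) by split; [exact: isom_mul | rewrite mulmxA sE ce scale0r subr0].
  have := H Q; lra.
have := cE vec_rho; rewrite (bZC symG vec_rho).
move=> /(congr1 (fun z : int => z%:~R : RR)); rewrite !intrM => cR h0'.
have q1 : 0 < (bZ G r r)%:~R :> RR by rewrite ltr0z.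
have : 0 <= (c vec_rho)%:~R * (bZ G r r)%:~R * bR G x2 (rmx r).
  by rewrite mulrAC mulr_ge0 // ltW.
rewrite cR -mulrA; lra.
Qed.

(** * The action on A2 when e is fixed *)

Definition vec_a1 : 'rV[int]_(2 + 2 + n) := mk 0 0 1 0 0.
Definition vec_a2 : 'rV[int]_(2 + 2 + n) := mk 0 0 0 1 0.

(** Dividing by the positive number -(x, e) gives a G2 alcove in the A2 plane. Its third wall is
    short: a 2-root of A2 plus any multiple of e is a root, whereas for k = 1, 2 a 6-root admits
    only multiples of 3 e. *)
Definition alcove (x : 'rV[RR]_(2 + 2 + n)) :=
  [/\ 0 < bR G x (rmx vec_a2), bR G x (rmx vec_a2) < bR G x (rmx vec_a1) &
      bR G x (rmx vec_a1) + bR G x (rmx vec_a2) < - bR G x (rmx vec_e)].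

Lemma bZN_ge0 v : 0 <= bZ N v v.
Proof. by rewrite -(ler_int RR) -bR_rmx. Qed.

Lemma bZN_eq0 v : bZ N v v = 0 -> v = 0.
Proof.
move=> v0; have [E hE] := definite_coord_bound symN psdN NS c0_neq0 0.
apply/rowP => j; rewrite mxE; apply/eqP; apply: contraT => vj.
have vj' : (v 0 j)%:~R != 0 :> RR by rewrite intr_eq0.
have := hE (((`|E| + 1) / (v 0 j)%:~R) *: rmx v).
rewrite bRZl bRZr bR_rmx v0 !mulr0 => /(_ (lexx _) j).
rewrite !mxE divfK // => h; have := ler_norm (`|E| + 1); have := ler_norm E; lra.
Qed.

Lemma bZ0 (v : 'rV[int]_n) : bZ N v 0 = 0.
Proof. by rewrite /bZ trmx0 mulmx0 mxE. Qed.
Lemma bZ0l (v : 'rV[int]_n) : bZ N 0 v = 0.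
Proof. by rewrite /bZ !mul0mx mxE. Qed.

Lemma orth_e_image g u : isometry G g -> vec_e *m g = vec_e -> bZ G u vec_e = 0 ->
  exists c m1 m2 v, u *m g = mk c 0 m1 m2 v.
Proof.
move=> gG ge ue; have [c [d [m1 [m2 [v E]]]]] := mk_surj (u *m g).
exists c, m1, m2, v; rewrite E; congr mk.
have : bZ G (u *m g) vec_e = 0 by rewrite -ge bZ_isom.
by rewrite E bZ_mk bZ0; lia.
Qed.

(** Modulo e, [g] acts on A2 + N. By evenness a vector of norm 2 there lies in A2 or in N, and a1,
    a2 go to the same summand since they are not orthogonal. N is excluded by the 6-root a1 - a2. *)
Lemma A2_image g : isometry G g -> Z3_reversing G g -> vec_e *m g = vec_e ->
  exists c1 c2 m11 m12 m21 m22,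
  [/\ vec_a1 *m g = mk c1 0 m11 m12 0, vec_a2 *m g = mk c2 0 m21 m22 0,
    m11 * m11 - m11 * m12 + m12 * m12 = 1 /\
    m21 * m21 - m21 * m22 + m22 * m22 = 1,
    2 * m11 * m21 - m11 * m22 - m12 * m21 + 2 * m12 * m22 = -1 &
    [/\ (3 %| c1 - c2)%Z, (3 %| m11 - m21 + 1)%Z & (3 %| m12 - m22 - 1)%Z]].
Proof.
move=> gG rg ge.
have [c1 [m11 [m12 [v1 E1]]]] : exists c m1 m2 v, vec_a1 *m g = mk c 0 m1 m2 v.
  by apply: orth_e_image => //; rewrite bZ_mk bZ0; lia.
have [c2 [m21 [m22 [v2 E2]]]] : exists c m1 m2 v, vec_a2 *m g = mk c 0 m1 m2 v.
  by apply: orth_e_image => //; rewrite bZ_mk bZ0; lia.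
have := bZ_isom vec_a1 vec_a1 gG; have := bZ_isom vec_a2 vec_a2 gG.
have := bZ_isom vec_a1 vec_a2 gG.
rewrite E1 E2 !bZ_mk !bZ0 => e12 e22 e11.
have zero2 (m1 m2 : int) v : 2 * m1 * m1 - m1 * m2 - m2 * m1 + 2 * m2 * m2 + bZ N v v = 2 ->
    v = 0 \/ (m1 = 0 /\ m2 = 0).
  move=> h; have := bZN_ge0 v; have /dvdzP[w wE] := evenN v.
  have [A0 A1] := A2_form_gt0 m1 m2 => v0.
  have [w0|w0] := eqVneq w 0; first by left; apply: bZN_eq0; rewrite wE w0 mul0r.
  by right; apply: A1; lia.
have v1v2 : v1 = 0 /\ v2 = 0.
  have [|v10|[m11' m12']] := zero2 m11 m12 v1; first by lia.
    split=> //; have [|//|[m21' m22']] := zero2 m21 m22 v2; first by lia.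
    by move: e12; rewrite m21' m22' v10 bZ0l; lia.
  have [|v20|[m21' m22']] := zero2 m21 m22 v2; first by lia.
    by move: e12; rewrite m11' m12' v20 bZ0; lia.
  (* [a1 - a2] pairs with the lattice in 3Z, so its image would be 3-divisible
     in [N] up to a factor prime to 3, against its norm 6 *)
  exfalso; pose w := v1 - v2.
  have w6 : bZ N w w = 6.
    rewrite /w -scaleN1r !bZDl !bZDr !bZZl !bZZr (bZC symN v2).
    move: e11 e22 e12; rewrite m11' m12' m21' m22'; lia.
  have dv z : (3 %| bZ N w z)%Z.
    have gu := isom_unit detG gG.
    have := bZ_isom (vec_a1 - vec_a2) ((mk 0 0 0 0 z : 'rV[int]_(2 + 2 + n)) *m invmx g) gG.
    rewrite mulmxKV // mulmxBl E1 E2 mkB m11' m12' m21' m22' -/w.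
    have [a [b [s [t [v ->]]]]] := mk_surj (mk 0 0 0 0 z *m invmx g).
    rewrite /vec_a1 /vec_a2 mkB !subrr !bZ_mk bZ0l => h.
    by apply/dvdzP; exists (s - t); lia.
  have [z zE] : exists z : 'rV[int]_n, w *m N = 3 *: z.
    exists (\row_j divz ((w *m N) 0 j) 3); apply/rowP => j.
    have := dv (delta_mx 0 j); rewrite /bZ trmx_delta -colE mxE.
    by move=> /dvdzP[y yE]; rewrite [RHS]mxE [X in _ * X]mxE yE mulzK // mulrC.
  have wz : c0 *: w = 3 *: (z *m S).
    by rewrite scalemxAl -zE -mulmxA NS mul_mx_scalar.
  have : bZ N (c0 *: w) (c0 *: w) = bZ N (3 *: (z *m S)) (3 *: (z *m S)) by rewrite wz.
  rewrite !bZZl !bZZr w6 => h.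
  have /dvdzP[q qE] : (3 %| c0 * c0)%Z.
    have /dvdzP[y yE] := evenN (z *m S).
    by apply/dvdzP; exists y; move: h; rewrite yE; lia.
  have : (3 %| c0)%Z.
    by have : (3 %| c0 * c0)%Z; [apply/dvdzP; exists q | rewrite !dvdzE abszM Euclid_dvdM // orbb].
  exact/negP.
case: v1v2 => v10 v20; move: E1 E2 e11 e22 e12; rewrite {}v10 {}v20 !bZ0.
move=> E1 E2 e11 e22 e12.
exists c1, c2, m11, m12, m21, m22; split=> //; [lia|lia|].
pose th : rat := 3^-1.
have th3 : th * 3 = 1 by [].
pose q0 : 'rV[rat]_n := 0.
(* (a1 - a2) / 3 generates the discriminant of A2; its image yields all three congruences, the one
   on the coefficients of e included. *)
have [||z] := rg (mk 0 0 th (- th) q0).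
- exists (mk 0 0 1 (-1) 0).
  have -> : mk 0 0 th (- th) q0 = th *: map_mx intr (mk 0 0 1 (-1) (0 : 'rV[int]_n)).
    rewrite map_mk mkZ !mulr0 mulr1 mulrN1; congr mk.
    by rewrite map_mx0 scaler0.
  rewrite -scalemxAl -map_mxM.
  have -> : mk 0 0 1 (-1) 0 *m G = 3 *: mk 0 0 1 (-1) 0.
    rewrite /mk /lat /osum !mul_row_block !mulmx0 !mul0mx !addr0 !add0r !scale_row_mx.
    rewrite scaler0; congr (row_mx (row_mx _ _) _).
      by apply/rowP => j; rewrite !mxE big_ord_recl big_ord1 !mxE !mul0r; case: ifP.
    apply/rowP => j; rewrite !mxE big_ord_recl big_ord1 !mxE /=.
    by case: j => [[|[|]]].
  by rewrite map_mxZ scalerA th3 scale1r.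
- exists 1%N, (mk 0 0 1 (-1) 0); rewrite expn1 -scaler_nat mkZ map_mk !mulr0.
  by congr mk; rewrite ?scaler0 ?map_mx0 //.
have -> : mk 0 0 th (- th) q0 = th *: map_mx intr (vec_a1 - vec_a2).
  rewrite /vec_a1 /vec_a2 -scaleN1r mkZ mkD map_mk mkZ; congr mk; rewrite ?mulr0 //.
  by rewrite scaler0 addr0 map_mx0 scaler0.
rewrite -scalemxAl -map_mxM mulmxBl E1 E2 -scalerDr -map_mxD.
move=> /(congr1 (fun y => (3 : rat) *: y)); rewrite scalerA mulrC th3 scale1r.
have [z1 [z2 [z3 [z4 [z5 ->]]]]] := mk_surj z.
rewrite /vec_a1 /vec_a2 -!scaleN1r !mkZ !mkD !map_mk mkZ => e.
have [e1 _ e3 e4 _] := mk_inj e.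
have i3 (p q : int) : (p%:~R : rat) = 3 * q%:~R -> p = 3 * q.
  by rewrite -(intrM _ 3) => /intr_inj.
have {}e1 := i3 _ _ e1; have {}e3 := i3 _ _ e3; have {}e4 := i3 _ _ e4.
by split; apply/dvdzP; [exists z1 | exists z3 | exists z4]; lia.
Qed.

Lemma alcove_contradiction g x : isometry G g -> Z3_reversing G g ->
  vec_e *m g = vec_e -> alcove x -> alcove (x *m rmx g) -> False.
Proof.
move=> gG rg ge.
have [c1 [c2 [m11 [m12 [m21 [m22 [E1 E2 [n1 n2] n12 [d0 d1 d2]]]]]]]] := A2_image gG rg ge.
set y := x *m rmx g.
have lin c m1 m2 : bR G y (rmx (mk c 0 m1 m2 0)) = c%:~R * bR G y (rmx vec_e) +
    m1%:~R * bR G y (rmx vec_a1) + m2%:~R * bR G y (rmx vec_a2).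
  rewrite -!bRZr -!bRDr -!map_mxZ -!map_mxD !mkZ !mkD; congr (bR _ _ (rmx _)).
  by congr mk; rewrite ?mulr0 ?mulr1 ?addr0 ?add0r // !scaler0 !addr0.
have ex : bR G y (rmx vec_e) = bR G x (rmx vec_e) by rewrite -{1}ge map_mxM bR_isom.
have a1 : bR G x (rmx vec_a1) = bR G y (rmx (mk c1 0 m11 m12 0)).
  by rewrite -E1 map_mxM bR_isom.
have a2 : bR G x (rmx vec_a2) = bR G y (rmx (mk c2 0 m21 m22 0)).
  by rewrite -E2 map_mxM bR_isom.
rewrite /alcove a1 a2 (lin c1) (lin c2) ex => -[x1 x2 x3] [y1 y2 y3].
exact: (alcove_rigid n1 n2 n12 d0 d1 d2 y1 y2 y3 x1 x2 x3).
Qed.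

Definition wall2 : 'rV[int]_(2 + 2 + n) := mk 0 0 1 (-1) 0.
Definition wall3 : 'rV[int]_(2 + 2 + n) := mk (-1) 0 (-1) (-1) 0.

Lemma root_wall1 : root_vec G vec_a2.
Proof. by left; rewrite bZ_mk bZ0; lia. Qed.

Lemma root_wall2 : root_vec G wall2.
Proof.
right; rewrite bZ_mk bZ0; split; first by lia.
move=> w; have [a [b [s [t [v ->]]]]] := mk_surj w.
by rewrite bZ_mk bZ0l; apply/dvdzP; exists (s - t); lia.
Qed.

Lemma root_wall3 : root_vec G wall3.
Proof. by left; rewrite bZ_mk bZ0; lia. Qed.

Lemma alcove_walls z : 0 < bR G z (rmx vec_a2) -> 0 < bR G z (rmx wall2) ->
  0 < bR G z (rmx wall3) -> alcove z.
Proof.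
have -> : wall2 = vec_a1 - vec_a2 by rewrite mkB !subrr subr0 sub0r.
have -> : wall3 = - vec_e - vec_a1 - vec_a2.
  rewrite -[- vec_e]sub0r -(mk0 int n) !mkB.
  by congr mk; rewrite !subr0.
by rewrite !map_mxB map_mxN !(bRDr, bRNr) /alcove => *; split; lra.
Qed.

(** * The cell of x and the image of e *)

Lemma root_neq0 g x r : normalized g x -> root_vec G r -> bR G x (rmx r) != 0.
Proof.
by case=> _ _ cg _ _; case: cg => _ + _ => /[apply]; apply: contraTneq => ->; rewrite mul0r ltxx.
Qed.

Lemma root_gt0_image g x r : normalized g x -> root_vec G r -> 0 < bR G x (rmx r) ->
  0 < bR G (x *m rmx g) (rmx r).
Proof. by case=> _ _ cg _ _; case: cg => _ + _ => /[apply] + x0; rewrite pmulr_rgt0. Qed.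

Lemma root_gt0 g x r : normalized g x -> root_vec G r -> 0 < bZ G r vec_e -> 0 < bR G x (rmx r).
Proof.
move=> nf; case: (nf) => gG rg cg xe xr.
move=> rr re; have [h _] := xr _ rr; rewrite lt_def (root_neq0 nf) //.
by move: h; rewrite pmulr_rge0 // ltr0z.
Qed.

Lemma wall_gt0 g x r : normalized g x -> root_vec G r -> bZ G r vec_e = 0 -> 0 < bZ G r vec_rho ->
  0 < bR G x (rmx r).
Proof.
move=> nf; case: (nf) => gG rg cg xe xr.
move=> rr re rrho; have [_ /(_ re) h] := xr _ rr; rewrite lt_def (root_neq0 nf) //.
by move: h; rewrite pmulr_rge0 // ltr0z.
Qed.

Lemma wall1_gt0 g x : normalized g x -> 0 < bR G x (rmx vec_a2).
Proof.
by move=> nf; apply: (wall_gt0 nf root_wall1); rewrite bZ_mk bZ0; lia.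
Qed.

Lemma wall2_gt0 g x : normalized g x -> 0 < bR G x (rmx wall2).
Proof.
by move=> nf; apply: (wall_gt0 nf root_wall2); rewrite bZ_mk bZ0; lia.
Qed.

Lemma wall3_gt0 g x : normalized g x -> 0 < bR G x (rmx wall3).
Proof.
by move=> nf; apply: (wall_gt0 nf root_wall3); rewrite bZ_mk bZ0; lia.
Qed.


Lemma alcove_x g x : normalized g x -> alcove x.
Proof.
move=> nf; apply: alcove_walls.
- exact: (wall1_gt0 nf).
- exact: (wall2_gt0 nf).
- exact: (wall3_gt0 nf).
Qed.

(** No mirror separates e from [x], hence, applying [g], none separates the image of e from that of
    [x], which lies on the same side as [x]. *)
Lemma root_ge0_image_e g x r : normalized g x -> root_vec G r -> 0 < bR G x (rmx r) ->
  0 <= bZ G r (vec_e *m g).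
Proof.
move=> nf; case: (nf) => gG rg cg xe xr.
move=> rr x0; have gu := isom_unit detG gG.
have [] := xr _ (root_isom detG (isom_inv detG gG) rr).
rewrite -(bZ_isom _ _ gG) mulmxKV // -(bR_isom _ _ gG) -map_mxM mulmxKV //.
by rewrite pmulr_lge0 ?ler0z //; exact: (root_gt0_image nf).
Qed.

(** The image is isotropic, so [a * b <= 0]; the signs are those of e because [g] preserves the half
    of the cone. *)
Lemma image_e_coords g x : normalized g x -> exists a b l1 l2 v, [/\ vec_e *m g = mk a b l1 l2 v,
  0 <= a, b <= 0 & 2 * k%:R * (a * b) +
    (2 * l1 * l1 - l1 * l2 - l2 * l1 + 2 * l2 * l2) + bZ N v v = 0].
Proof.
move=> nf; case: (nf) => gG rg cg xe xr.
have [a [b [l1 [l2 [v E]]]]] := mk_surj (vec_e *m g).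
have e0 : bZ G (vec_e *m g) (vec_e *m g) = 0 by rewrite bZ_isom // bZ_ee.
move: (e0); rewrite E bZ_mk => e1.
have v0 := bZN_ge0 v; have [A0 _] := A2_form_gt0 l1 l2.
have kp : 0 < k%:R :> int by rewrite ltr0n.
have ab : a * b <= 0 by nia.
have [h|h] := boolP ((0 <= a) && (b <= 0)).
  by exists a, b, l1, l2, v; case/andP: h => a0 b0; split=> //; rewrite -e1; ring.
exfalso; have [a0 b0 ab0] : [/\ 0 <= - a, - b <= 0 & (a != 0) || (b != 0)].
  by split; nia.
case: cg => xx _ xg.
have yy : bR G (x *m rmx g) (x *m rmx g) < 0 by rewrite bR_isom.
have fe := future_e.
have ee : bR G (rmx vec_e) (rmx vec_e) <= 0 by rewrite bR_rmx bZ_ee.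
have fx := future_of_lt0 xx ee fe xe.
have fy : future (x *m rmx g).
  by apply: (future_of_lt0 yy (ltW xx) fx); rewrite (bRC symG).
have fN : future (- rmx (vec_e *m g)).
  exists (- a)%:~R, (- b)%:~R, (- l1)%:~R, (- l2)%:~R, (rmx (- v)).
  rewrite -map_mxN E -scaleN1r mkZ rmx_mk !mulN1r scaleN1r.
  split=> //; rewrite ?ler0z ?lerz0 //.
  by rewrite xpair_eqE !intr_eq0 !oppr_eq0 negb_and.
have ye : bR G (x *m rmx g) (rmx (vec_e *m g)) < 0 by rewrite map_mxM bR_isom.
have := future_bR_lt0 k0 symN psdN yy fy fN.
rewrite bRN !bRNr opprK bR_rmx e0 => /(_ (lexx _)); lra.
Qed.

Lemma image_e_primitive g x c w : normalized g x -> vec_e *m g = c *: w -> (c %| 1)%Z.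
Proof.
move=> nf; case: (nf) => gG rg cg xe xr.
move=> E; have gu := isom_unit detG gG.
have : vec_e = c *: (w *m invmx g) by rewrite scalemxAl -E mulmxK.
have [a [b [s [t [v ->]]]]] := mk_surj (w *m invmx g).
rewrite mkZ => e; have [h _ _ _ _] := mk_inj e.
by apply/dvdzP; exists a; rewrite mulrC -h.
Qed.

Lemma image_e_b0 g x a l1 l2 v : normalized g x -> vec_e *m g = mk a 0 l1 l2 v -> 0 <= a ->
  (2 * l1 * l1 - l1 * l2 - l2 * l1 + 2 * l2 * l2) + bZ N v v = 0 ->
  vec_e *m g = vec_e.
Proof.
move=> nf; case: (nf) => gG rg cg xe xr.
move=> E a0 e0; have v0 := bZN_ge0 v; have [A0 A1] := A2_form_gt0 l1 l2.
have [l10 l20] : l1 = 0 /\ l2 = 0 by apply: A1; lia.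
have vz : v = 0 by apply: bZN_eq0; lia.
move: E; rewrite l10 l20 vz => E.
have : (a %| 1)%Z.
  apply: (@image_e_primitive g x a vec_e nf); rewrite E mkZ; congr mk; rewrite ?mulr1 ?mulr0 //.
  by rewrite scaler0.
by rewrite dvdz1 E => /eqP a1; congr mk; lia.
Qed.

(** For the root r = al e + f + m one has (r, e) = k > 0 and, the image of e being isotropic, 2 b
    (r, eg) = 2 b^2 - |b m - l|^2. With [b < 0] the last hypothesis makes (r, eg) negative. *)
Lemma image_e_separated g x a b l1 l2 v al m1 m2 w :
  normalized g x -> vec_e *m g = mk a b l1 l2 v -> b < 0 ->
  2 * k%:R * (a * b) +
    (2 * l1 * l1 - l1 * l2 - l2 * l1 + 2 * l2 * l2) + bZ N v v = 0 ->
  2 * k%:R * al + (2 * m1 * m1 - m1 * m2 - m2 * m1 + 2 * m2 * m2) + bZ N w w = 2 ->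
  let p := b * m1 - l1 in let q := b * m2 - l2 in
  2 * p * p - p * q - q * p + 2 * q * q + bZ N (b *: w - v) (b *: w - v) < 2 * (b * b) ->
  False.
Proof.
move=> nf; case: (nf) => gG rg cg xe xr.
move=> E b0 e0 r2 p q lt2.
have kp : 0 < k%:R :> int by rewrite ltr0n.
have rr : root_vec G (mk al 1 m1 m2 w) by left; rewrite bZ_mk -[RHS]r2; ring.
have re : 0 < bZ G (mk al 1 m1 m2 w) vec_e by rewrite bZ_mk bZ0; lia.
have := root_ge0_image_e nf rr (root_gt0 nf rr re); rewrite E bZ_mk.
move: lt2; rewrite -scaleN1r !(bZDl, bZDr, bZZl, bZZr) (bZC symN v w).
move: (bZ N w w) (bZ N w v) (bZ N v v) r2 e0 => ww wv vv r2 e0 lt2 ge0.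
set r := _ + _ + wv in ge0.
have : 2 * b * r = 2 * (b * b) - (2 * p * p - p * q - q * p + 2 * q * q +
    (b * (b * ww) + -1 * (b * wv) + (b * (-1 * wv) + -1 * (-1 * vv)))).
  rewrite /r /p /q.
  have -> : ww = 2 - 2 * k%:R * al - (2 * m1 * m1 - m1 * m2 - m2 * m1 + 2 * m2 * m2) by lia.
  have -> : vv = - (2 * k%:R * (a * b)) - (2 * l1 * l1 - l1 * l2 - l2 * l1 + 2 * l2 * l2) by lia.
  by ring.
move=> h; have : 2 * b * r <= 0 by nia.
by lia.
Qed.

Lemma alcove_image g x : normalized g x -> alcove (x *m rmx g).
Proof.
move=> nf; apply: alcove_walls; apply: (root_gt0_image nf).
- exact: root_wall1.
- exact: (wall1_gt0 nf).
- exact: root_wall2.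
- exact: (wall2_gt0 nf).
- exact: root_wall3.
- exact: (wall3_gt0 nf).
Qed.

Lemma fixed_e_contradiction g x : normalized g x -> vec_e *m g = vec_e -> False.
Proof.
move=> nf ge; case: (nf) => gG rg _ _ _.
apply: (alcove_contradiction gG rg ge); [exact: (alcove_x nf) | exact: (alcove_image nf)].
Qed.

Lemma achiral_normalized : achiral G -> exists g x, normalized g x.
Proof.
move=> [g [gG rg cell]].
have [x cg] := direct_cell_preserving symG (bR_cone_neq0 k0 symN psdN) cell.
exact: normal_form gG rg cg.
Qed.

Lemma chiral_U : k = 1%N ->
  (forall y, exists w : 'rV[int]_n, bR N (y - rmx w) (y - rmx w) <= 1) ->
  chiral G.
Proof.
move=> k1 coverN /achiral_normalized[g [x nf]].
have [a [b [l1 [l2 [v [E a0 b0 e0]]]]]] := image_e_coords nf.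
have [bz|bn] := eqVneq b 0.
  apply: (fixed_e_contradiction nf); apply: (image_e_b0 nf _ a0 (l1 := l1) (l2 := l2) (v := v)).
    by rewrite E bz.
  by rewrite -e0 bz; ring.
have bR0 : b%:~R != 0 :> RR by rewrite intr_eq0.
have [m1 [m2 /= hA]] := A2_cover (l1%:~R / b%:~R) (l2%:~R / b%:~R).
have [w hN] := coverN (b%:~R^-1 *: rmx v).
(* For [k = 1] the multiple of e can correct any even norm to 2. *)
have [al alE] : exists al : int, 2 * k%:R * al +
    (2 * m1 * m1 - m1 * m2 - m2 * m1 + 2 * m2 * m2) + bZ N w w = 2.
  have /dvdzP[q ->] := evenN w.
  by exists (1 - q - (m1 * m1 - m1 * m2 + m2 * m2)); rewrite k1; ring.
apply: (image_e_separated nf E _ e0 alE) => /=; first by lia.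
rewrite -(ltr_int RR) !(intrD, intrM, intrN) -bR_rmx.
have -> : rmx (b *: w - v) = (- b%:~R) *: (b%:~R^-1 *: rmx v - rmx w).
  rewrite map_mxB map_mxZ scalerBr scalerA mulNr divff // scaleN1r scaleNr opprK.
  by rewrite addrC.
rewrite bRZl bRZr; move: hN hA; set Q := bR N _ _.
set u := _ - m1%:~R; set u' := _ - m2%:~R => hN hA.
have -> : b%:~R * m1%:~R - l1%:~R = - b%:~R * u :> RR by rewrite /u; field.
have -> : b%:~R * m2%:~R - l2%:~R = - b%:~R * u' :> RR by rewrite /u'; field.
set B : RR := b%:~R in bR0 *.
have BB : 0 < B * B by rewrite -expr2 exprn_even_gt0.
(* A2 contributes less than 1 and N at most 1, so the sum is strictly below 2. *)
have : B * B * (2 * (u * u - u * u' + u' * u') + Q) < B * B * 2 by rewrite ltr_pM2l //; lra.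
by rewrite !mulr1z; lra.
Qed.

(** The reflection in e + f. For k = 2 this vector has norm 4 and is not a root, so the symmetry is
    not visible in W. *)
Definition swap : 'M[int]_(2 + 2 + n) := osum (osum (- U) 1%:M) 1%:M.

Lemma mk_swap (R : pzRingType) (a b s t : R) (v : 'rV[R]_n) :
  mk a b s t v *m map_mx intr swap = mk (- b) (- a) s t v.
Proof.
rewrite /mk /swap /osum !map_block_mx !map_mx0 !map_mx1 !mul_row_block !mulmx0 !mulmx1.
rewrite !addr0 !add0r; congr (row_mx (row_mx _ _) _).
apply/rowP => j; rewrite !mxE big_ord_recl big_ord1 !mxE /=.
by case: j => [[|[|]]] //= _; rewrite ?oppr0 ?mulr0 ?addr0 ?add0r ?mulrN1z ?mulrN1.
Qed.

Lemma mk_swapZ (a b s t : int) (v : 'rV[int]_n) :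
  mk a b s t v *m swap = mk (- b) (- a) s t v.
Proof.
rewrite -(mk_swap a b s t v); congr (_ *m _).
by apply/matrixP => i j; rewrite [RHS]mxE intz.
Qed.

Lemma swap_isometry : isometry G swap.
Proof.
apply: isometry_of_bZ => u v.
have [a [b [s [t [w ->]]]]] := mk_surj u; have [a' [b' [s' [t' [w' ->]]]]] := mk_surj v.
by rewrite !mk_swapZ !bZ_mk; ring.
Qed.

Lemma mk_lat (a b s t : rat) (v : 'rV[rat]_n) : mk a b s t v *m map_mx intr G =
  mk (k%:R * b) (k%:R * a) (2 * s - t) (2 * t - s) (v *m map_mx intr N).
Proof.
rewrite /mk /lat /osum !map_block_mx !map_mx0 !mul_row_block !mulmx0 !addr0 !add0r.
congr (row_mx (row_mx _ _) _); apply/rowP => j.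
  rewrite !mxE big_ord_recl big_ord1 !mxE !mulmxnE !mxE /=.
  by case: j => [[|[|]]] //= _; rewrite /eq_op /= ?mul0rn -?pmulrn; ring.
rewrite !mxE big_ord_recl big_ord1 !mxE /edges /=.
by case: j => [[|[|]]] //= _; rewrite /eq_op /=; ring.
Qed.

(** The discriminant of U(2) is a 2-group: a dual vector of 3-power order modulo the lattice has
    integral U(2) coordinates, so [swap] moves it by a lattice vector. *)
Lemma swap_reversing g : k = 2%N -> Z3_reversing G g -> Z3_reversing G (g *m swap).
Proof.
move=> k2 rg x xd [l xl]; have [z zE] := rg x xd (ex_intro _ l xl).
have [a [b [s [t [v xE]]]]] := mk_surj x.
(* Bezout for 2 and 3^l, using 3^l = 2 m + 1. *)
have int_of (c : rat) (p q : int) : c * 2 = p%:~R -> c * (3 ^ l)%:R = q%:~R ->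
    exists r : int, c = r%:~R.
  move=> cp cq; pose m := ((3 ^ l)./2)%N.
  have lE : (3 ^ l = 2 * m + 1)%N.
    by rewrite -(odd_double_half (3 ^ l)) oddX orbT addnC mul2n.
  exists (q - m%:Z * p); rewrite intrB intrM -cp -cq lE natrD natrM pmulrn; ring.
have [p pE] := xd; have [q qE] := xl.
have [p1 [p2 [p3 [p4 [p5 pE']]]]] := mk_surj p.
have [q1 [q2 [q3 [q4 [q5 qE']]]]] := mk_surj q.
have pq : mk (2 * b) (2 * a) (2 * s - t) (2 * t - s)
    (v *m map_mx intr N) = map_mx intr p.
  by rewrite -pE xE mk_lat k2.
move: pq; rewrite pE' map_mk => e; have [pa pb _ _ _] := mk_inj e.
rewrite xE qE' map_mk -scaler_nat mkZ in qE; have [qa qb _ _ _] := mk_inj qE.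
have [ra raE] : exists r : int, a = r%:~R by apply: (int_of _ p2 q1); lra.
have [rb rbE] : exists r : int, b = r%:~R by apply: (int_of _ p1 q2); lra.
exists (z *m swap + mk (ra + rb) (ra + rb) 0 0 0).
rewrite map_mxD !map_mxM -zE mulmxDl -addrA !mulmxA; congr (_ + _).
rewrite xE mk_swap (map_mk intr (ra + rb) (ra + rb)) mkD !intrD raE rbE.
by congr mk; rewrite ?map_mx0 ?addr0 //; ring.
Qed.

Lemma chiral_U2 : k = 2%N -> n = 0%N -> chiral G.
Proof.
move=> k2 n0 /achiral_normalized[g [x nf]].
have v0 (v : 'rV[int]_n) : v = 0.
  by apply/rowP => j; have := ltn_ord j; rewrite [X in (_ < X)%N]n0.
have [a [b [l1 [l2 [v [E a0 b0 e0]]]]]] := image_e_coords nf.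
have [bz|bn] := eqVneq b 0.
  apply: (fixed_e_contradiction nf); apply: (image_e_b0 nf _ a0 (l1 := l1) (l2 := l2) (v := v)).
    by rewrite E bz.
  by rewrite -e0 bz; ring.
move: E e0; rewrite (v0 v) bZ0 => E e0.
have bR0 : b%:~R != 0 :> RR by rewrite intr_eq0.
case: (A2_cover_odd (l1%:~R / b%:~R) (l2%:~R / b%:~R)).
  move=> [m1 [m2 [odd12 /= hA]]].
  (* Outside 2 A2 the norm is 2 modulo 4, as the equation with 4 al requires. *)
  have [al alE] : exists al : int, 2 * k%:R * al +
      (2 * m1 * m1 - m1 * m2 - m2 * m1 + 2 * m2 * m2) + bZ N 0 0 = 2.
    have half (m : int) : exists p i : int, m = 2 * p + i /\ (i = 0 \/ i = 1).
      by exists (m %/ 2)%Z, (m %% 2)%Z; lia.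
    have [p1 [i1 [E1 h1]]] := half m1; have [p2 [i2 [E2 h2]]] := half m2.
    rewrite k2 bZ0.
    have : ~ (i1 = 0 /\ i2 = 0).
      by move=> [i10 i20]; move/negP: odd12; apply; apply/andP; split; lia.
    case: h1 h2 => [h1|h1] [h2|h2] ni; subst i1 i2; first by case: ni.
    - exists (- (2 * p1 * p1 - 2 * p1 * p2 - p1 + 2 * p2 * p2 + 2 * p2)).
      by rewrite E1 E2; ring.
    - exists (- (2 * p1 * p1 + 2 * p1 - 2 * p1 * p2 - p2 + 2 * p2 * p2)).
      by rewrite E1 E2; ring.
    - exists (- (2 * p1 * p1 + 2 * p1 - 2 * p1 * p2 - p1 - p2 + 2 * p2 * p2 + 2 * p2)).
      by rewrite E1 E2; ring.
  apply: (image_e_separated nf E _ _ alE) => /=; [by lia | by rewrite bZ0; lia |].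
  rewrite (v0 (_ - _)) bZ0 -(ltr_int RR) !(intrD, intrM, intrN).
  move: hA; set u := _ - m1%:~R; set u' := _ - m2%:~R => hA.
  have -> : b%:~R * m1%:~R - l1%:~R = - b%:~R * u :> RR by rewrite /u; field.
  have -> : b%:~R * m2%:~R - l2%:~R = - b%:~R * u' :> RR by rewrite /u'; field.
  set B : RR := b%:~R in bR0 *.
  have BB : 0 < B * B by rewrite -expr2 exprn_even_gt0.
  have : B * B * (2 * (u * u - u * u' + u' * u')) < B * B * 2 by rewrite ltr_pM2l //; lra.
  by rewrite !mulr1z; lra.
(* Here l = 2 b h with h in A2; isotropy makes the image of e divisible by b, and primitivity gives
   b = -1. *)
move=> [h1 [h2 [/(canRL (divfK bR0)) e1 /(canRL (divfK bR0)) e2]]].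
have {}e1 : l1 = 2 * h1 * b by apply: (@intr_inj RR); rewrite e1 !intrM.
have {}e2 : l2 = 2 * h2 * b by apply: (@intr_inj RR); rewrite e2 !intrM.
have aE : a = - 2 * b * (h1 * h1 - h1 * h2 + h2 * h2).
  apply: (mulIf bn); apply: (mulfI (_ : (4 : int) != 0)) => //.
  by move: e0; rewrite k2 e1 e2; lia.
have b1 : b = -1.
  have : (b %| 1)%Z.
    apply: (@image_e_primitive g x b
      (mk (- 2 * (h1 * h1 - h1 * h2 + h2 * h2)) 1 (2 * h1) (2 * h2) 0) nf).
    by rewrite E mkZ scaler0; congr mk; rewrite ?aE ?e1 ?e2; ring.
  by rewrite dvdz1; lia.
(* The walls put -h in the closed alcove bounded by the value 1 on a1 + a2, where 0 is the only
   vector of A2. *)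
have w1 := root_ge0_image_e nf root_wall1 (wall1_gt0 nf).
have w2 := root_ge0_image_e nf root_wall2 (wall2_gt0 nf).
have w3 := root_ge0_image_e nf root_wall3 (wall3_gt0 nf).
move: w1 w2 w3; rewrite E !bZ_mk !bZ0 k2 e1 e2 b1 => w1 w2 w3.
have h10 : h1 = 0 by lia.
have h20 : h2 = 0 by lia.
have ge : vec_e *m (g *m swap) = vec_e.
  rewrite mulmxA E mk_swapZ; congr mk; rewrite ?aE ?e1 ?e2 ?h10 ?h20 b1 //.
case: (nf) => gG rg _ _ _.
apply: (alcove_contradiction (isom_mul gG swap_isometry) (swap_reversing k2 rg) ge (x := x)).
  exact: (alcove_x nf).
have bS u : bR G (x *m rmx (g *m swap)) (rmx (u *m swap)) = bR G (x *m rmx g) (rmx u).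
  by rewrite !map_mxM mulmxA bR_isom //; exact: swap_isometry.
have s1 : vec_a2 *m swap = vec_a2 by rewrite mk_swapZ oppr0.
have s2 : wall2 *m swap = wall2 by rewrite mk_swapZ oppr0.
(* The root f - a1 - a2 is the mirror image of [wall3]; it pairs positively with e, so its sign at
   [x] is known. *)
pose wall4 : 'rV[int]_(2 + 2 + n) := mk 0 1 (-1) (-1) 0.
have s3 : wall4 *m swap = wall3 by rewrite mk_swapZ oppr0.
apply: alcove_walls; [rewrite -s1 bS | rewrite -s2 bS | rewrite -s3 bS];
  apply: (root_gt0_image nf).
- exact: root_wall1.
- exact: (wall1_gt0 nf).
- exact: root_wall2.
- exact: (wall2_gt0 nf).
- by left; rewrite bZ_mk bZ0; lia.
apply: (root_gt0 nf); first by left; rewrite bZ_mk bZ0; lia.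
by rewrite bZ_mk bZ0 k2; lia.
Qed.

End Chirality.

(** * Matrices as lists *)

(* Matrices given by lists of rows, so that matrix identities reduce to
   computations on closed lists of integers. *)
Definition entry (s : seq (seq int)) i j := nth 0 (nth [::] s i) j.

Definition lmx m n (s : seq (seq int)) : 'M[int]_(m, n) :=
  \matrix_(i, j) entry s i j.

Definition lgen m n (f : nat -> nat -> int) : seq (seq int) :=
  mkseq (fun i => mkseq (f i) n) m.

Lemma lmx_gen m n f : lmx m n (lgen m n f) = \matrix_(i, j) f i j.
Proof. by apply/matrixP => i j; rewrite !mxE /entry !nth_mkseq. Qed.

Definition lmul m n p s t := lgen m p (fun i j =>
  foldr (fun l c => entry s i l * entry t l j + c) 0 (iota 0 n)).

Lemma lmx_mul m n p s t : lmx m n s *m lmx n p t = lmx m p (lmul m n p s t).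
Proof.
rewrite lmx_gen; apply/matrixP => i j; rewrite !mxE.
under eq_bigr do rewrite !mxE.
rewrite -(big_mkord xpredT (fun l => entry s i l * entry t l j)) /index_iota subn0.
by rewrite unlock; elim: (iota 0 n) => //= l r ->.
Qed.

Definition ltr m n s := lgen m n (fun i j => entry s j i).

Lemma lmx_tr m n s : (lmx m n s)^T = lmx n m (ltr n m s).
Proof. by rewrite lmx_gen; apply/matrixP => i j; rewrite !mxE. Qed.

Definition lsub m n s t := lgen m n (fun i j => entry s i j - entry t i j).

Lemma lmx_sub m n s t : lmx m n s - lmx m n t = lmx m n (lsub m n s t).
Proof. by rewrite lmx_gen; apply/matrixP => i j; rewrite !mxE. Qed.

Definition lscale c m n s := lgen m n (fun i j => c * entry s i j).

Lemma lmx_scale c m n s : c *: lmx m n s = lmx m n (lscale c m n s).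
Proof. by rewrite lmx_gen; apply/matrixP => i j; rewrite !mxE. Qed.

Definition lscalar c n := lgen n n (fun i j => if i == j then c else 0).

Lemma lmx_scalar c n : c%:M = lmx n n (lscalar c n).
Proof.
rewrite lmx_gen; apply/matrixP => i j; rewrite !mxE -[i == j :> nat]/(i == j).
by case: eqP.
Qed.

Definition losum m n s t := lgen (m + n) (m + n) (fun i j =>
  if (i < m)%N then if (j < m)%N then entry s i j else 0
  else if (j < m)%N then 0 else entry t (i - m) (j - m)).

Lemma lmx_osum m n s t : osum (lmx m m s) (lmx n n t) = lmx (m + n) (m + n) (losum m n s t).
Proof.
rewrite lmx_gen; apply/matrixP => i j; rewrite [RHS]mxE.
case: (split_ordP i) => i' ->; case: (split_ordP j) => j' ->.
- by rewrite block_mxEul !mxE.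
- by rewrite block_mxEur !mxE.
- by rewrite block_mxEdl !mxE.
- by rewrite block_mxEdr !mxE /= !addKn.
Qed.

Definition lcartan n (s : seq (nat * nat)) := lgen n n (fun i j =>
  if i == j then 2 else if ((i, j) \in s) || ((j, i) \in s) then -1 else 0).

Lemma lmx_cartan n s : cartan (@edges n s) = lmx n n (lcartan n s).
Proof. by rewrite lmx_gen; apply/matrixP => i j; rewrite !mxE. Qed.

Lemma lmx_U : U = lmx 2 2 [:: [:: 0; 1]; [:: 1; 0]].
Proof. by apply/matrixP => -[[|[|]]] // ? [[|[|]]] // ?; rewrite !mxE. Qed.

Lemma lmx_scale2 n s : scale2 (lmx n n s) = lmx n n (lscale 2 n n s).
Proof. by rewrite /scale2 -scaler_nat lmx_scale. Qed.

Lemma sym_even n (M : 'M[int]_n) v : M^T = M -> (forall i, M i i = 2) ->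
  (2 %| bZ M v v)%Z.
Proof.
move=> symM M2; pose T : 'M[int]_n := \matrix_(i, j)
  (if (i < j)%N then M i j else if i == j then 1 else 0).
have ME : M = T + T^T.
  apply/matrixP => i j; have := congr1 (fun A : 'M[int]_n => A i j) symM.
  rewrite mxE !mxE; have [ij|ij|/ord_inj <-] := ltngtP i j; last by rewrite eqxx M2.
    by rewrite -val_eqE /= gtn_eqF // addr0.
  by rewrite -[i == j]val_eqE /= gtn_eqF // add0r.
rewrite ME /bZ mulmxDr mulmxDl mxE.
have -> : v *m T^T *m v^T = (v *m T *m v^T)^T by rewrite !trmx_mul trmxK mulmxA.
by rewrite [X in _ + X]mxE; apply/dvdzP; eexists; rewrite -mulr2n -[LHS]mulr_natr.
Qed.

Lemma cartan_even n (e : 'I_n -> 'I_n -> bool) v : (2 %| bZ (cartan e) v v)%Z.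
Proof. by apply: sym_even; [exact: cartan_sym | move=> i; rewrite mxE eqxx]. Qed.

(** * Covering radii of D4 and E8 *)

(** Integer, sign and distance form one triple so that [choice] turns them into functions of the
    coordinate. *)
Lemma nearest_int (z : RR) : exists t : int * int * RR,
  [/\ z = t.1.1%:~R + t.1.2%:~R * t.2, t.1.2 = 1 \/ t.1.2 = -1 & 0 <= t.2 <= 1 / 2].
Proof.
have [m [u [-> /andP[u0 u1]]]] := frac_part z.
have [h|h] := leP u (1 / 2).
  by exists (m, 1, u); split=> /=; [rewrite mulr1z mul1r | left | rewrite u0].
exists (m + 1, -1, 1 - u); split=> /=; [rewrite intrD mulrN1z mulr1z; ring | by right |].
by apply/andP; split; lra.
Qed.

Section Covering.
Variables (n : nat) (z : 'I_n.+1 -> RR) (m e : 'I_n.+1 -> int) (d : 'I_n.+1 -> RR).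
Hypothesis zE : forall i, z i = (m i)%:~R + (e i)%:~R * d i.
Hypothesis eE : forall i, e i = 1 \/ e i = -1.
Hypothesis dE : forall i, 0 <= d i <= 1 / 2.

Let N := \sum_i d i ^+ 2.
Let S := \sum_i d i.

Lemma sqr_sign i : ((e i)%:~R : RR) ^+ 2 = 1.
Proof. by case: (eE i) => ->; rewrite ?mulrN1z ?mulr1z ?sqrrN expr1n. Qed.

(** Every coordinate follows one quadratic polynomial in its distance except [i0], the one rounded
    the other way. *)
Lemma sum_flip (i0 : 'I_n.+1) (x y : RR) (F : 'I_n.+1 -> RR) :
  (forall i, i != i0 -> F i = d i ^+ 2 + x * d i + y) ->
  \sum_i F i = N + x * S + n.+1%:R * y + (F i0 - (d i0 ^+ 2 + x * d i0 + y)).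
Proof.
move=> FE; rewrite (bigD1 i0) //= (eq_bigr _ FE).
have -> : N + x * S + n.+1%:R * y = \sum_i (d i ^+ 2 + x * d i + y).
  by rewrite !big_split /= -mulr_sumr sumr_const card_ord mulr_natl.
by rewrite [in RHS](bigD1 i0) //=; ring.
Qed.

Lemma sum_add_at (i0 : 'I_n.+1) (f : 'I_n.+1 -> int) (c : int) :
  \sum_i (f i + (i == i0)%:R * c) = \sum_i f i + c.
Proof.
rewrite big_split /=; congr (_ + _); rewrite (bigD1 i0) //= eqxx mul1r big1 ?addr0 //.
by move=> i /negPf->; rewrite mul0r.
Qed.

Lemma odd_even (c : int) : exists h : int, c = 2 * h \/ c = 2 * h + 1.
Proof. by exists (c %/ 2)%Z; lia. Qed.

(** An odd coordinate sum is repaired by moving coordinate [i0] to its second nearest integer, at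
    the cost (1 - d)^2 - d^2 = 1 - 2 d. *)
Lemma round_int i0 (h : int) : \sum_i m i = 2 * h \/ \sum_i m i = 2 * h + 1 ->
  exists (V : 'I_n.+1 -> int) (h' : int), \sum_i V i = 2 * h' /\
  (\sum_i (z i - (V i)%:~R) ^+ 2 = N /\ \sum_i m i = 2 * h \/
   \sum_i (z i - (V i)%:~R) ^+ 2 = N + 1 - 2 * d i0 /\ \sum_i m i = 2 * h + 1).
Proof.
case=> mh.
  exists m, h; split=> //; left; split=> //; apply: eq_bigr => i _.
  by rewrite zE addrAC subrr add0r exprMn sqr_sign mul1r.
have [h' h'E] : exists h' : int, 2 * h + 1 + e i0 = 2 * h'.
  by case: (eE i0) => ->; [exists (h + 1) | exists h]; lia.
exists (fun i => m i + (i == i0)%:R * e i0), h'; split; first by rewrite sum_add_at mh.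
right; split=> //; rewrite (@sum_flip i0 0 0).
  rewrite eqxx mul1r zE intrD; case: (eE i0) => ->; rewrite ?mulrN1z ?mulr1z; ring.
move=> i /negPf ii; rewrite ii zE mul0r addr0 addrAC subrr add0r exprMn sqr_sign.
by ring.
Qed.

(** The nearest half-integer is at distance 1/2 - d; parity is repaired at the cost (1/2 + d)^2 -
    (1/2 - d)^2 = 2 d. *)
Lemma round_half i0 : exists (V : 'I_n.+1 -> int) (h' : int), \sum_i V i = 2 * h' /\
  (\sum_i (z i - (V i)%:~R - 1 / 2) ^+ 2 = N - S + n.+1%:R / 4 \/
   \sum_i (z i - (V i)%:~R - 1 / 2) ^+ 2 = N - S + n.+1%:R / 4 + 2 * d i0).
Proof.
have [v vE] : exists v : 'I_n.+1 -> int, forall i, 2 * v i + 1 = 2 * m i + e i.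
  by exists (fun i => if e i == 1 then m i else m i - 1) => i; case: (eE i) => -> /=; lia.
have vR i : (v i)%:~R = (m i)%:~R + ((e i)%:~R - 1) / 2 :> RR.
  have := congr1 (fun c : int => c%:~R : RR) (vE i); rewrite !intrD !intrM; lra.
have base i : (z i - (v i)%:~R - 1 / 2) ^+ 2 = d i ^+ 2 + (- 1) * d i + 1 / 4.
  by rewrite zE vR; case: (eE i) => ->; rewrite ?mulrN1z ?mulr1z; field.
have [h [vh|vh]] := odd_even (\sum_i v i).
  exists v, h; split=> //; left; rewrite (@sum_flip i0 (- 1) (1 / 4)) //.
  by rewrite base; lra.
have [h' h'E] : exists h' : int, 2 * h + 1 - e i0 = 2 * h'.
  by case: (eE i0) => ->; [exists h | exists (h + 1)]; lia.
exists (fun i => v i + (i == i0)%:R * - e i0), h'; split; first by rewrite sum_add_at vh.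
right; rewrite (@sum_flip i0 (- 1) (1 / 4)).
  rewrite eqxx mul1r zE intrD vR; case: (eE i0) => ->;
    by rewrite ?opprK ?mulrN1z ?mulr1z; field.
by move=> i /negPf ii; rewrite ii mul0r addr0 base.
Qed.

Lemma sum_sqr_le (a b : RR) : (forall i, a <= d i <= b) ->
  N <= (a + b) * S - n.+1%:R * (a * b).
Proof.
move=> ab; have -> : (a + b) * S - n.+1%:R * (a * b) = \sum_i ((a + b) * d i - a * b).
  by rewrite big_split /= -mulr_sumr sumr_const card_ord mulr_natl mulNrn.
apply: ler_sum => i _; have /andP[h1 h2] := ab i; rewrite -subr_ge0.
by have -> : (a + b) * d i - a * b - d i ^+ 2 = (d i - a) * (b - d i);
  [ring | apply: mulr_ge0; lra].
Qed.

Lemma sum_bounds (a b : RR) : (forall i, a <= d i <= b) ->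
  n.+1%:R * a <= S <= n.+1%:R * b.
Proof.
move=> ab; have cst c : n.+1%:R * c = \sum_(i < n.+1) c :> RR.
  by rewrite sumr_const card_ord mulr_natl.
by rewrite !cst; apply/andP; split; apply: ler_sum => i _; have /andP[] := ab i.
Qed.

End Covering.

Lemma D4_point_cover (z : 'I_4 -> RR) : exists (V : 'I_4 -> int) (h : int),
  \sum_i V i = 2 * h /\ \sum_i (z i - (V i)%:~R) ^+ 2 <= 1.
Proof.
have /choice[f fP] := fun i => nearest_int (z i).
pose m i := (f i).1.1; pose e i := (f i).1.2; pose d i := (f i).2.
have zE i : z i = (m i)%:~R + (e i)%:~R * d i by case: (fP i).
have eE i : e i = 1 \/ e i = -1 by case: (fP i).
have dE i : 0 <= d i <= 1 / 2 by case: (fP i).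
have [i1 _ max1] := @arg_maxP _ _ _ (ord0 : 'I_4) xpredT d isT.
have [h hE] := odd_even (\sum_i m i).
have [V [h' [VE V1]]] := round_int zE eE i1 hE.
exists V, h'; split=> //.
have dM i : 0 <= d i <= d i1 by have /andP[-> _] := dE i; apply: max1.
have NM := sum_sqr_le dM; have SM := sum_bounds dM.
have /andP[d0 d1] := dE i1.
(* Re-rounding at the largest distance D is cheapest. The sum of squares is at most D times the sum,
   hence at most 4 D^2, and both 4 D^2 and 4 D^2 + 1 - 2 D are at most 1 for D in [0, 1/2]. *)
case: V1 => [[-> _]|[-> _]]; move: NM SM; move: (\sum_i _) (\sum_i _) (d i1) d0 d1 => P Q D.
  by move=> d0 d1 NM /andP[_ SM]; nra.
by move=> d0 d1 NM /andP[_ SM]; nra.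
Qed.

(** E8 is the union of D8 and its translate by the half-sum of the basis; a point far from one of
    them is near the other. *)
Lemma E8_point_cover (z : 'I_8 -> RR) : exists (c : int) (V : 'I_8 -> int) (h : int),
  \sum_i V i = 2 * h /\ \sum_i (z i - (V i)%:~R - c%:~R / 2) ^+ 2 <= 1.
Proof.
have /choice[f fP] := fun i => nearest_int (z i).
pose m i := (f i).1.1; pose e i := (f i).1.2; pose d i := (f i).2.
have zE i : z i = (m i)%:~R + (e i)%:~R * d i by case: (fP i).
have eE i : e i = 1 \/ e i = -1 by case: (fP i).
have dE i : 0 <= d i <= 1 / 2 by case: (fP i).
have [i1 _ max1] := @arg_maxP _ _ _ (ord0 : 'I_8) xpredT d isT.
have [i0 _ min0] := @arg_minP _ _ _ (ord0 : 'I_8) xpredT d isT.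
have [h hE] := odd_even (\sum_i m i).
have [V [h1 [VE V1]]] := round_int zE eE i1 hE.
have [W [h2 [WE W1]]] := round_half zE eE i0.
have [le1|gt1] := leP (\sum_i (z i - (V i)%:~R) ^+ 2) 1.
  exists 0, V, h1; split=> //; apply: le_trans le1; apply: ler_sum => i _.
  by rewrite mul0r subr0.
exists 1, W, h2; split=> //.
have eqW : \sum_i (z i - (W i)%:~R - 1%:~R / 2) ^+ 2 = \sum_i (z i - (W i)%:~R - 1 / 2) ^+ 2.
  by apply: eq_bigr => i _; rewrite mulr1z.
rewrite {}eqW leNgt; apply/negP => gt2.
have mM i : d i0 <= d i <= d i1 by apply/andP; split; [exact: min0 | exact: max1].
have /andP[a0 a1] := dE i0; have /andP[b0 b1] := dE i1.
have ab : d i0 <= d i1 by exact: min0.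
have mh i : d i0 <= d i <= 1 / 2 by have /andP[_ ->] := dE i; rewrite andbT; exact: min0.
have zM i : 0 <= d i <= d i1 by have /andP[-> _] := dE i; exact: max1.
have N1 := sum_sqr_le mM; have N2 := sum_sqr_le mh; have N3 := sum_sqr_le zM.
have N4 := sum_sqr_le dE.
have SM := sum_bounds mM.
have gtV : 1 < \sum_i d i ^+ 2 \/ 1 < \sum_i d i ^+ 2 + 1 - 2 * d i1.
  by case: V1 => [[<- _]|[<- _]]; [left|right].
have gtW : 1 < \sum_i d i ^+ 2 - \sum_i d i + 8 / 4 \/
           1 < \sum_i d i ^+ 2 - \sum_i d i + 8 / 4 + 2 * d i0.
  by case: W1 => [<-|<-]; [left|right].
clear -a0 a1 b0 b1 ab N1 N2 N3 N4 SM gtV gtW; move: gtV gtW N1 N2 N3 N4 SM.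
move: (\sum_i d i ^+ 2) (\sum_i d i) (d i0) (d i1) a0 a1 b0 b1 ab.
move=> N S a b a0 a1 b0 b1 ab gtV gtW N1 N2 N3 N4 /andP[S1 S2].
(* The cases record which rounding needed a parity repair. Each combines S < N + 1, or S < N + 1 + 2
   a, with a bound of N by S given by [sum_sqr_le]. *)
case: gtV gtW => [nv|nv] [nw|nw].
- lra.
- have [ha|ha] := ltP a (1 / 2); last by nra.
  have : N * (1 / 2 - a) <= 2 * (1 / 2 - a) * (1 / 2 - a) by nra.
  nra.
- nra.
- have [ha|ha] := ltP (a + b) 1; last by nra.
  have h1 : N * (1 - a - b) <= (a + b) * (1 + 2 * a) - 8 * (a * b) by nra.
  have h2 : 2 * b * (1 - a - b) < N * (1 - a - b) by rewrite ltr_pM2r; lra.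
  have h3 : 0 <= (b - a) * (1 - 2 * (b - a)) by apply: mulr_ge0; lra.
  nra.
Qed.

Section RootLattice.
Variables (n : nat) (N B Q1 : 'M[int]_n.+1) (q2 q3 : 'rV[int]_n.+1) (c : nat).
Hypotheses (c0 : (0 < c)%N) (NB : (c ^ 2)%:R *: N = B *m B^T).

(** [B / c] lists the simple roots in orthonormal coordinates; [c = 2] clears the halves of E8. *)
Lemma bR_coords (v : 'rV[RR]_n.+1) :
  bR N v v = \sum_j ((v *m rmx B) 0 j / c%:R) ^+ 2.
Proof.
have cR : c%:R != 0 :> RR by rewrite pnatr_eq0 -lt0n.
apply: (mulfI (_ : (c ^ 2)%:R != 0 :> RR)); first by rewrite natrX expf_neq0.
have BB : rmx B *m (rmx B)^T = (c ^ 2)%:R *: rmx N.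
  by rewrite map_trmx -map_mxM -NB map_mxZ rmorph_nat.
have -> : (c ^ 2)%:R * bR N v v = ((v *m rmx B) *m (v *m rmx B)^T) 0 0.
  rewrite trmx_mul -!mulmxA (mulmxA (rmx B)) BB -scalemxAl -scalemxAr [RHS]mxE.
  by rewrite mulmxA.
rewrite mxE mulr_sumr; apply: eq_bigr => j _; rewrite [_^T _ _]mxE natrX expr_div_n.
by rewrite -expr2; field.
Qed.

Lemma psd_of_coords (v : 'rV[RR]_n.+1) : 0 <= bR N v v.
Proof. by rewrite bR_coords; apply: sumr_ge0 => j _; exact: sqr_ge0. Qed.

Hypothesis Q1B : Q1 *m B = \matrix_(i, j) (c%:R * ((i == j)%:R - (j == 0)%:R)).
Hypothesis q2B : q2 *m B = \row_j (2 * c%:R * (j == 0)%:R).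

(** [Q1] and [q2] express eps_j - eps_0 and 2 eps_0 in simple roots; they generate all integer
    vectors of even sum. [q3] adds the glue vector of E8. *)
Lemma cover_of_coords (y : 'rV[RR]_n.+1) (d : int) (V : 'I_n.+1 -> int) (h : int) :
  d = 0 \/ q3 *m B = const_mx 1 -> \sum_i V i = 2 * h ->
  \sum_j ((y *m rmx B) 0 j / c%:R - (V j)%:~R - d%:~R / c%:R) ^+ 2 <= 1 ->
  exists w : 'rV[int]_n.+1, bR N (y - rmx w) (y - rmx w) <= 1.
Proof.
move=> dE Vh; have cR : c%:R != 0 :> RR by rewrite pnatr_eq0 -lt0n.
have dq : d *: (q3 *m B) = const_mx d.
  by apply/rowP => j; case: dE => ->; rewrite ?scale0r !mxE ?mulr1.
exists ((\row_j V j) *m Q1 + h *: q2 + d *: q3).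
rewrite bR_coords; apply: le_trans; last by eassumption.
apply: ler_sum => j _; rewrite mulmxBl -map_mxM !mulmxDl -mulmxA Q1B -!scalemxAl q2B dq.
set w := _ + _ + _; suff wE : w 0 j = c%:R * V j + d.
  have -> : (y *m rmx B - rmx w) 0 j = (y *m rmx B) 0 j - (w 0 j)%:~R.
    by rewrite mxE [X in _ + X]mxE [X in - X]mxE.
  rewrite wE intrD intrM mulrBl mulrDl mulrAC.
  by have -> : (c%:R : int)%:~R = c%:R :> RR;
    [rewrite rmorph_nat | rewrite divff // mul1r opprD addrA].
rewrite /w !mxE; under eq_bigr do rewrite !mxE.
have -> : \sum_i V i * (c%:R * ((i == j)%:R - (j == 0)%:R)) =
    c%:R * (V j - (j == 0)%:R * (2 * h)).
  rewrite -Vh; transitivity (\sum_i (c%:R * ((i == j)%:R * V i) -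
      c%:R * (j == 0)%:R * V i)); first by apply: eq_bigr => i _; ring.
  rewrite sumrB -!mulr_sumr (bigD1 j) //= eqxx mul1r big1 => [|i /negPf->]; last by rewrite mul0r.
  by rewrite addr0 -mulrA -mulrBr.
by ring.
Qed.

End RootLattice.

Definition D4_coords : seq (seq int) :=
  [:: [:: 1; -1; 0; 0]; [:: 0; 1; -1; 0]; [:: 0; 0; 1; -1]; [:: 0; 0; 1; 1]].
(* Twice the simple roots of E8 in orthonormal coordinates *)
Definition E8_coords : seq (seq int) :=
  [:: [:: 1; -1; -1; -1; -1; -1; -1; 1]; [:: 2; 2; 0; 0; 0; 0; 0; 0];
      [:: -2; 2; 0; 0; 0; 0; 0; 0]; [:: 0; -2; 2; 0; 0; 0; 0; 0];
      [:: 0; 0; -2; 2; 0; 0; 0; 0]; [:: 0; 0; 0; -2; 2; 0; 0; 0];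
      [:: 0; 0; 0; 0; -2; 2; 0; 0]; [:: 0; 0; 0; 0; 0; -2; 2; 0]].
Definition E8_inverse : seq (seq int) :=
  [:: [:: 4; 5; 7; 10; 8; 6; 4; 2]; [:: 5; 8; 10; 15; 12; 9; 6; 3];
      [:: 7; 10; 14; 20; 16; 12; 8; 4]; [:: 10; 15; 20; 30; 24; 18; 12; 6];
      [:: 8; 12; 16; 24; 20; 15; 10; 5]; [:: 6; 9; 12; 18; 15; 12; 8; 4];
      [:: 4; 6; 8; 12; 10; 8; 6; 3]; [:: 2; 3; 4; 6; 5; 4; 3; 2]].
Definition D4_inverse2 : seq (seq int) :=
  [:: [:: 2; 2; 1; 1]; [:: 2; 4; 2; 2]; [:: 1; 2; 2; 1]; [:: 1; 2; 1; 2]].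

Definition shear n (c : int) :=
  lgen n n (fun i j => c * ((i == j)%:R - (j == 0)%N%:R)).
Definition corner n (c : int) := lgen 1 n (fun _ j => c * (j == 0)%N%:R).

Lemma lmx_shear n (c : int) : lmx n.+1 n.+1 (shear n.+1 c) =
  \matrix_(i, j) (c * ((i == j)%:R - (j == 0)%:R)).
Proof. by rewrite lmx_gen; apply/matrixP => i j; rewrite !mxE. Qed.

Lemma lmx_corner n (c : int) : lmx 1 n.+1 (corner n.+1 c) =
  \row_j (c * (j == 0)%:R).
Proof. by rewrite lmx_gen; apply/matrixP => i j; rewrite !mxE. Qed.

Lemma lmx_eq m n s t : s == t -> lmx m n s = lmx m n t.
Proof. by move=> /eqP->. Qed.

Lemma D4_factor : (1 ^ 2)%:R *: D4 = lmx 4 4 D4_coords *m (lmx 4 4 D4_coords)^T.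
Proof.
by rewrite /D4 lmx_cartan lmx_scale lmx_tr lmx_mul; apply: lmx_eq; vm_compute.
Qed.

Lemma E8_factor : (2 ^ 2)%:R *: E8 = lmx 8 8 E8_coords *m (lmx 8 8 E8_coords)^T.
Proof.
by rewrite /E8 lmx_cartan lmx_scale lmx_tr lmx_mul; apply: lmx_eq; vm_compute.
Qed.

Lemma D4_cover (y : 'rV[RR]_4) :
  exists w : 'rV[int]_4, bR D4 (y - rmx w) (y - rmx w) <= 1.
Proof.
have [V [h [Vh le1]]] := D4_point_cover (fun j => (y *m rmx (lmx 4 4 D4_coords)) 0 j / 1%:R).
apply: (@cover_of_coords 3 D4 (lmx 4 4 D4_coords)
  (lmx 4 4 [:: [:: 0; 0; 0; 0]; [:: -1; 0; 0; 0]; [:: -1; -1; 0; 0]; [:: -1; -1; -1; 0]])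
  (lmx 1 4 [:: [:: 2; 2; 1; 1]]) 0 1 _ D4_factor _ _ y 0 V h) => //.
- by rewrite -lmx_shear lmx_mul; apply: lmx_eq; vm_compute.
- by rewrite -lmx_corner lmx_mul; apply: lmx_eq; vm_compute.
- by left.
by apply: le_trans le1; apply: ler_sum => j _; rewrite mul0r subr0.
Qed.

Lemma E8_cover (y : 'rV[RR]_8) :
  exists w : 'rV[int]_8, bR E8 (y - rmx w) (y - rmx w) <= 1.
Proof.
have [c [V [h [Vh le1]]]] :=
  E8_point_cover (fun j => (y *m rmx (lmx 8 8 E8_coords)) 0 j / 2%:R).
apply: (@cover_of_coords 7 E8 (lmx 8 8 E8_coords)
  (lmx 8 8 [:: [:: 0; 0; 0; 0; 0; 0; 0; 0]; [:: 0; 0; 1; 0; 0; 0; 0; 0];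
    [:: 0; 0; 1; 1; 0; 0; 0; 0]; [:: 0; 0; 1; 1; 1; 0; 0; 0];
    [:: 0; 0; 1; 1; 1; 1; 0; 0]; [:: 0; 0; 1; 1; 1; 1; 1; 0];
    [:: 0; 0; 1; 1; 1; 1; 1; 1]; [:: 2; 2; 4; 5; 4; 3; 2; 1]])
  (lmx 1 8 [:: [:: 0; 1; -1; 0; 0; 0; 0; 0]])
  (lmx 1 8 [:: [:: 1; 3; 3; 5; 4; 3; 2; 1]]) 2 _ E8_factor _ _ y c V h) => //.
- by rewrite -lmx_shear lmx_mul; apply: lmx_eq; vm_compute.
- by rewrite -lmx_corner lmx_mul; apply: lmx_eq; vm_compute.
right; have -> : const_mx 1 = lmx 1 8 [:: nseq 8 1].
  by apply/rowP => j; rewrite !mxE /entry (nth_nseq 0 8) ltn_ord.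
by rewrite lmx_mul; apply: lmx_eq; vm_compute.
Qed.

(** * The four chiral lattices *)

Lemma chiral_U_A2_D4 : chiral (osum (osum U A2) D4).
Proof.
have DS : D4 *m lmx 4 4 D4_inverse2 = 2%:M.
  by rewrite /D4 lmx_cartan lmx_mul lmx_scalar; apply: lmx_eq; vm_compute.
rewrite -[osum _ _]/(lat 1 D4).
refine (chiral_U _ (cartan_sym _) (psd_of_coords (c := 1) isT D4_factor) DS _ _ _ _) => //.
- exact: cartan_even.
- exact: D4_cover.
Qed.

Lemma chiral_U_A2_E8 : chiral (osum (osum U A2) E8).
Proof.
have ES : E8 *m lmx 8 8 E8_inverse = 1%:M.
  by rewrite /E8 lmx_cartan lmx_mul lmx_scalar; apply: lmx_eq; vm_compute.
rewrite -[osum _ _]/(lat 1 E8).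
refine (chiral_U _ (cartan_sym _) (psd_of_coords (c := 2) isT E8_factor) ES _ _ _ _) => //.
- exact: cartan_even.
- exact: E8_cover.
Qed.

Lemma bR_dim0 (N : 'M[int]_0) x y : bR N x y = 0.
Proof. by rewrite /bR (thinmx0 x) !mul0mx mxE. Qed.

Lemma bZ_dim0 (N : 'M[int]_0) x y : bZ N x y = 0.
Proof. by rewrite /bZ (thinmx0 x) !mul0mx mxE. Qed.

Lemma lat_dim0 k : lat k (0 : 'M[int]_0) = osum (U *+ k) A2.
Proof.
apply/matrixP => i j; rewrite /lat {1}/osum.
(* [2 + 2 + 0] computes to [2 + 2], so the index types are convertible. *)
have -> : i = lshift 0 (i : 'I_(2 + 2)) by apply/val_inj.
have -> : j = lshift 0 (j : 'I_(2 + 2)) by apply/val_inj.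
rewrite block_mxEul; congr (osum _ _ _ _); exact/val_inj.
Qed.

Lemma chiral_U_A2 : chiral (osum U A2).
Proof.
rewrite -[osum _ _](lat_dim0 1).
refine (@chiral_U 1 0 0 0 1 isT (trmx0 _ _ _) _ _ _ _ _ _) => //.
- by move=> v; rewrite bR_dim0.
- by rewrite (flatmx0 (_ *m _)) (flatmx0 1%:M).
- by move=> v; rewrite bZ_dim0.
- by move=> y; exists 0; rewrite bR_dim0.
Qed.

Lemma chiral_U2_A2 : chiral (osum (scale2 U) A2).
Proof.
rewrite -[osum _ _](lat_dim0 2).
refine (@chiral_U2 2 0 0 0 1 isT (trmx0 _ _ _) _ _ _ _ _ _) => //.
- by move=> v; rewrite bR_dim0.
- by rewrite (flatmx0 (_ *m _)) (flatmx0 1%:M).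
- by move=> v; rewrite bZ_dim0.
Qed.

(** * Achirality *)

Lemma poly_roots_seq (F : fieldType) (p : {poly F}) : p != 0 ->
  exists s : seq F, forall x, root p x -> x \in s.
Proof.
move: {2}(size p) (leqnn (size p)) => l; elim: l p => [|l IHl] p.
  by rewrite leqn0 size_poly_eq0 => ->.
move=> pl p0; have [[a pa]|no] := pselect (exists a, root p a); last first.
  by exists [::] => x px; case: no; exists x.
have /factor_theorem[q pE] := pa; move: p0 pl; rewrite pE.
have [->|q0] := eqVneq q 0; first by rewrite mul0r eqxx.
rewrite size_Mmonic ?monicXsubC // size_XsubC addn2 => _ ql.
have [s sP] := IHl q ql q0; exists (a :: s) => x.
by rewrite rootM root_XsubC inE orbC => /orP[->//|/sP->]; rewrite orbT.
Qed.

Lemma exists_notin_countable (d : RR) (A : set RR) : 0 < d -> countable A ->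
  exists2 t, 0 < t < d & ~ A t.
Proof.
move=> d0 cA; apply: contrapT => no.
have sub : [set` `]0, d[] `<=` A.
  move=> t /=; rewrite in_itv /= => td; apply: contrapT => At; apply: no.
  by exists t.
have := countable_lebesgue_measure0 (sub_countable (subset_card_le sub) cA).
by rewrite lebesgue_measure_itv /= lte_fin d0 sube0 => -[] d1; move: d0; rewrite d1 ltxx.
Qed.

Section GenericPoint.
Variables (n : nat) (G h : 'M[int]_n) (u : 'rV[int]_n).

(* A point on the moment curve through [u]: a nonzero linear form on it is a
   nonzero polynomial in the parameter. *)
Let X (i : 'I_n) : {poly RR} := (u 0 i)%:~R%:P + 'X^(i.+1).
Let x t : 'rV[RR]_n := \row_i (X i).[t].

(** The condition [h *m G *m v^T != 0] says that the mirror of [v] does not contain the image of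
    [h]. Each such [v] excludes finitely many parameters, countably many in all, while negativity at
    [u] persists on an interval. *)
Lemma generic_point : bZ G (u *m h) (u *m h) < 0 ->
  exists y : 'rV[RR]_n, bR G (y *m rmx h) (y *m rmx h) < 0 /\
  forall v : 'rV[int]_n, h *m G *m v^T != 0 -> bR G (y *m rmx h) (rmx v) != 0.
Proof.
move=> uu.
pose A := rmx (h *m G *m h^T).
pose q : {poly RR} := \sum_j (\sum_i X i * (A i j)%:P) * X j.
have qE t : bR G (x t *m rmx h) (x t *m rmx h) = q.[t].
  have -> : bR G (x t *m rmx h) (x t *m rmx h) = (x t *m A *m (x t)^T) 0 0.
    by rewrite /bR /A !map_mxM trmx_mul map_trmx !mulmxA.
  rewrite /q horner_sum mxE; apply: eq_bigr => j _; rewrite hornerM !mxE horner_sum.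
  by congr (_ * _); apply: eq_bigr => i _; rewrite hornerM hornerC !mxE.
have q0 : q.[0] < 0.
  rewrite -qE; have -> : x 0 = rmx u.
    by apply/rowP => i; rewrite !mxE hornerD hornerC hornerXn expr0n /= addr0.
  by rewrite -map_mxM bR_rmx ltrz0.
have [d d0 qd] : exists2 d : RR, 0 < d & forall t, 0 < t < d -> q.[t] < 0.
  have := (@continuous_horner _ q) 0 => /cvgr_lt /(_ _ q0).
  rewrite /= -nbhs_ballE => -[d /= d0 qd]; exists d => // t /andP[t0 td].
  by apply: qd; rewrite /ball /= sub0r normrN gtr0_norm.
pose p (v : 'rV[int]_n) : {poly RR} := \sum_i X i * (((h *m G *m v^T) i 0)%:~R)%:P.
have pE v t : bR G (x t *m rmx h) (rmx v) = (p v).[t].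
  have -> : bR G (x t *m rmx h) (rmx v) = (x t *m rmx (h *m G *m v^T)) 0 0.
    by rewrite /bR !map_mxM map_trmx !mulmxA.
  by rewrite horner_sum mxE; apply: eq_bigr => i _; rewrite hornerM hornerC !mxE.
have p_neq0 v : h *m G *m v^T != 0 -> p v != 0.
  apply: contra_neq => p0; apply/colP => j; rewrite [RHS]mxE.
  (* The exponents [i.+1] are distinct and positive, so degree [j.+1] isolates coordinate [j] from
     the constants. *)
  have := congr1 (fun r : {poly RR} => r`_j.+1) p0; rewrite coef0 coef_sum (bigD1 j) //=.
  rewrite big1 => [|i ij].
    rewrite coefMC coefD coefC coefXn eqxx /= add0r addr0 mul1r => /eqP.
    by rewrite intr_eq0 => /eqP.
  have ji : (j.+1 == i.+1) = false by rewrite eqSS eq_sym; exact: negPf.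
  by rewrite coefMC coefD coefC coefXn ji addr0 mul0r.
pose bad := \bigcup_(v in [set v : 'rV[int]_n | h *m G *m v^T != 0]) [set t | root (p v) t].
have cbad : countable bad.
  apply: bigcup_countable => [|v /p_neq0 /poly_roots_seq[s sP]]; first exact: countableP.
  apply: (@sub_countable _ _ _ [set` s]); last exact/finite_set_countable/finite_seq.
  exact/subset_card_le.
have [t /qd tq tbad] := exists_notin_countable d0 cbad.
exists (x t); split; first by rewrite qE.
move=> v hv; rewrite pE; apply/negP => r0; apply: tbad; exists v => //.
Qed.

End GenericPoint.

(** The image of the component of a fixed point is connected and contains that point, so it stays
    inside; applying [g] twice gives equality. *)
Lemma involution_direct n (G g : 'M[int]_n) (x : 'rV[RR]_n) : \det G != 0 ->
  isometry G g -> g *m g = 1%:M -> x *m rmx g = x -> cone_minus_mirrors G x ->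
  exists P, lifted_cell G P /\ direct g P.
Proof.
move=> dG gG gg xg Ax; set A := cone_minus_mirrors G in Ax *.
have ggR (y : 'rV[RR]_n) : y *m rmx g *m rmx g = y.
  by rewrite -mulmxA -map_mxM gg map_mx1 mulmx1.
have gA y : A y -> A (y *m rmx g).
  move=> [yy yr]; split; first by rewrite bR_isom.
  move=> v vr; rewrite -(bR_isom _ _ gG) ggR -map_mxM.
  by apply: yr; exact: root_isom.
exists (connected_component A x); split; first by exists x.
set P := connected_component A x; pose f (y : 'rV[RR]_n) := y *m rmx g.
have Pf : f @` P `<=` P.
  apply: connected_component_max.
  - by exists x => //; exact: connected_component_refl.
  - by move=> _ [y /connected_component_sub Ay <-]; exact: gA.
  apply: connected_continuous_connected; first exact: component_connected.
  by apply: continuous_subspaceT; exact: continuous_mulmxr.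
apply/seteqP; split=> // y Py; exists (f y); last exact: ggR.
by apply: Pf; exists y.
Qed.

Lemma subrDD (V : zmodType) (x : V) : x - (x + x) = - x.
Proof. by rewrite opprD addrA subrr add0r. Qed.

Lemma scalemxI m n (c : int) (A B : 'M[int]_(m, n)) : c != 0 -> c *: A = c *: B -> A = B.
Proof.
move=> c0 /matrixP e; apply/matrixP => i j.
by have := e i j; rewrite !mxE => /(mulfI c0).
Qed.

Lemma E6_sym : E6^T = E6.
Proof. exact: cartan_sym. Qed.

(** * The involution attached to a sublattice E6(2) *)

Section Criterion.
Variables (n : nat) (G Gi S : 'M[int]_n) (B : 'M[int]_(6, n)) (D C : 'M[int]_(n, 6)).
Variable u : 'rV[int]_n.
Hypotheses (symG : G^T = G) (GGi : G *m Gi = 12%:M).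
Hypotheses (DE : D *m E6 = G *m B^T) (BD : B *m D = 2%:M) (BC : B *m C = 1%:M).

(** The rows of [B] span K, and [v *m D *m B] is twice the projection of [v] to K; integrality of
    [D] says that projections lie in K/2. So [h] is twice the projection to the orthogonal
    complement, and [g] is -1 on K and +1 on that complement. *)
Let h := 2%:M - D *m B.
Let g := 1%:M - D *m B.

Hypotheses (GiS : Gi *m h = 6 *: S) (neg : bZ G (u *m h) (u *m h) < 0).

Let BG : B *m G = E6 *m D^T.
Proof. by rewrite -[LHS]trmxK trmx_mul symG -DE trmx_mul E6_sym. Qed.

Let BGB : B *m G *m B^T = 2 *: E6.
Proof. by rewrite BG -mulmxA -trmx_mul BD tr_scalar_mx mul_mx_scalar. Qed.

Let DBDB : D *m B *m (D *m B) = 2 *: (D *m B).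
Proof. by rewrite mulmxA -(mulmxA D) BD mul_mx_scalar scalemxAl. Qed.

Let gG : isometry G g.
Proof.
have DED : G *m (D *m B)^T = D *m B *m G.
  by rewrite trmx_mul mulmxA -DE -!mulmxA BG.
rewrite /Defs.isometry /g linearB /= trmx1 -mulmxA mulmxBr mulmx1 DED.
rewrite mulmxBl mul1mx mulmxBr (mulmxA (D *m B)) DBDB -scalemxAl scaler_nat mulr2n.
by rewrite (subrDD (D *m B *m G)) opprK subrK.
Qed.

Let gg : g *m g = 1%:M.
Proof.
rewrite /g mulmxBr mulmx1 mulmxBl mul1mx DBDB scaler_nat mulr2n.
by rewrite (subrDD (D *m B)) opprK subrK.
Qed.

Let hg : h *m g = h.
Proof.
rewrite /h /g mulmxBr mulmx1 mulmxBl mul_scalar_mx DBDB.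
by rewrite subrr subr0.
Qed.

Let G_nondeg : \det G != 0.
Proof.
have := congr1 determinant GGi; rewrite det_mulmx det_scalar => e.
by apply/eqP => d0; move: e; rewrite d0 mul0r => /esym/eqP; rewrite expf_eq0 andbF.
Qed.

(** [v] is orthogonal to the complement of K, hence in the rational span of K; [C] shows K
    primitive, so [v] lies in K itself. *)
Lemma coinvariant_norm (v : 'rV[int]_n) : h *m G *m v^T = 0 -> (4 %| bZ G v v)%Z.
Proof.
move=> hv.
have hGs : (h *m G)^T = h *m G.
  by rewrite /h mulmxBl mul_scalar_mx -mulmxA BG linearB /= linearZ /= symG !trmx_mul
    trmxK E6_sym mulmxA.
have vhG : v *m h *m G = 0.
  have := congr1 trmx hv; rewrite trmx_mul trmxK hGs trmx0.
  by rewrite mulmxA.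
have vh : v *m h = 0.
  have := congr1 (mulmxr Gi) vhG.
  rewrite /= -(mulmxA (v *m h)) GGi mul_mx_scalar mul0mx => e.
  by apply: (@scalemxI _ _ 12) => //; rewrite scaler0.
have v2 : 2 *: v = v *m D *m B.
  by move/eqP: vh; rewrite /h mulmxBr mul_mx_scalar subr_eq0 mulmxA => /eqP.
have vDC : v *m D = 2 *: (v *m C).
  by rewrite scalemxAl v2 -mulmxA BC mulmx1.
have vE : v = v *m C *m B.
  apply: (@scalemxI _ _ 2) => //.
  by rewrite v2 vDC -scalemxAl.
have -> : bZ G v v = 2 * bZ E6 (v *m C) (v *m C).
  rewrite {1 2}vE /bZ trmx_mul -!mulmxA (mulmxA B) (mulmxA (B *m G)) BGB.
  by rewrite -scalemxAl -!scalemxAr mxE !mulmxA.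
have /dvdzP[q ->] : (2 %| bZ E6 (v *m C) (v *m C))%Z by exact: cartan_even.
by apply/dvdzP; exists q; ring.
Qed.

(** [g + 1 = h], and [GiS] says that 2 h maps the dual into the lattice. On a class of order a power
    of 3, the factor 2 is invertible. *)
Lemma Z3_reversing_g : Z3_reversing G g.
Proof.
move=> x [z xz] [l [y yl]].
pose Q := (map_mx intr : 'M[int]_n -> 'M[rat]_n).
have -> : x *m map_mx intr g + x = x *m Q h.
  have -> : h = g + 1%:M.
    by rewrite /h /g addrAC; congr (_ - _); apply/matrixP => i j; rewrite !mxE -mulrnDl.
  by rewrite [in RHS]/Q (map_mxD _ g 1%:M) map_mx1 mulmxDr mulmx1.
have e2 : 2 *: (x *m Q h) = map_mx intr (z *m S).
  have : 6 *: (2 *: (x *m Q h)) = 6 *: map_mx intr (z *m S).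
    transitivity (map_mx (intr : int -> rat) (6 *: (z *m S))); last by rewrite map_mxZ.
    rewrite scalerA [in RHS]scalemxAr -GiS mulmxA !map_mxM -xz -!mulmxA.
    by rewrite (mulmxA (map_mx _ G)) -map_mxM GGi map_scalar_mx mul_scalar_mx -scalemxAr.
  exact: scalerI.
have e3 : (3 ^ l)%:R *: (x *m Q h) = map_mx intr (y *m h).
  by rewrite scalemxAl scaler_nat yl map_mxM.
have lE : (3 ^ l = 2 * (3 ^ l)./2 + 1)%N.
  by rewrite -{1}(odd_double_half (3 ^ l)) oddX orbT addnC mul2n.
(* The Bezout relation is 1 = 3^l - 2 m with m the half of 3^l rounded down. *)
exists (y *m h - ((3 ^ l)./2)%:Z *: (z *m S)).
rewrite map_mxB map_mxZ -e2 -e3 {1}lE scalerA -scalerBl.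
by set c := (X in X *: _); have -> : c = 1;
  [rewrite /c /= -pmulrn natrD natrM; ring | rewrite scale1r].
Qed.

Lemma achiral_coinvariant_E6 : achiral G.
Proof.
have [y [yy yv]] := generic_point neg.
exists g; split; [exact: gG | exact: Z3_reversing_g |].
apply: (involution_direct (x := y *m rmx h) G_nondeg gG gg).
  by rewrite -mulmxA -map_mxM hg.
split=> // v rv; apply: yv; apply/eqP => /coinvariant_norm.
by case: rv => [->|[-> _]].
Qed.

End Criterion.

(** * Certificates for the twelve achiral lattices *)

Definition E6_list : seq (seq int) :=
  lcartan 6 [:: (0, 2); (2, 3); (3, 4); (4, 5); (1, 3)]%N.
Definition E6_inverse3 : seq (seq int) :=
  [:: [:: 4; 3; 5; 6; 4; 2]; [:: 3; 6; 6; 9; 6; 3]; [:: 5; 6; 10; 12; 8; 4];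
      [:: 6; 9; 12; 18; 12; 6]; [:: 4; 6; 8; 12; 10; 5]; [:: 2; 3; 4; 6; 5; 4]].

Definition ldiv c m n s := lgen m n (fun i j => divz (entry s i j) c).

(* [B] is a basis of a sublattice E6(2) of [G], [C] a dual system showing that it
   is primitive, [Gi] is 12 times the inverse of [G]. *)
Definition E6_certificate n (G Gi B C : seq (seq int)) : bool :=
  let GB := lmul n n 6 G (ltr n 6 B) in
  let D := ldiv 3 n 6 (lmul n 6 6 GB E6_inverse3) in
  let h := lsub n n (lscalar 2 n) (lmul n 6 n D B) in
  let Gih := lmul n n n Gi h in
  let uh := lmul 1 n n [:: [:: 1; -1]] h in
  [&& ltr n n G == lgen n n (entry G), lmul n n n G Gi == lscalar 12 n,
      lmul n 6 6 D E6_list == GB, lmul 6 n 6 B D == lscalar 2 6,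
      lmul 6 n 6 B (ltr n 6 C) == lscalar 1 6,
      Gih == lscale 6 n n (ldiv 6 n n Gih)
    & entry (lmul 1 n 1 (lmul 1 n n uh G) (ltr n 1 uh)) 0 0 < 0].

Lemma lmx_entry m n s : lmx m n (lgen m n (entry s)) = lmx m n s.
Proof. by rewrite lmx_gen. Qed.

(** The quotients in the certificate are candidates, confirmed by multiplying back. The row
    [[:: 1; -1]], with missing entries read as 0, is e - f in every application: its norm is
    negative, and removing its component along the positive definite K keeps it so. *)
Lemma achiral_of_certificate n G Gi B C : E6_certificate n G Gi B C ->
  achiral (lmx n n G).
Proof.
rewrite /E6_certificate; set GB := lmul n n 6 G _; set D := ldiv 3 n 6 _.
set h := lsub n n _ _; set Gih := lmul n n n Gi h; set uh := lmul 1 n n _ h.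
case/and5P=> /eqP symG /eqP GGi /eqP DE /eqP BD /and3P[/eqP BC /eqP GiS neg].
have hE : 2%:M - lmx n 6 D *m lmx 6 n B = lmx n n h.
  by rewrite lmx_scalar lmx_mul lmx_sub.
apply: (@achiral_coinvariant_E6 n _ (lmx n n Gi) (lmx n n (ldiv 6 n n Gih))
  (lmx 6 n B) (lmx n 6 D) (lmx n 6 (ltr n 6 C)) (lmx 1 n [:: [:: 1; -1]])).
- by rewrite lmx_tr symG lmx_entry.
- by rewrite lmx_mul GGi lmx_scalar.
- by rewrite /E6 lmx_cartan lmx_mul lmx_tr lmx_mul -/GB -DE.
- by rewrite lmx_mul BD lmx_scalar.
- by rewrite lmx_mul BC lmx_scalar.
- by rewrite hE lmx_mul lmx_scale -GiS.
by rewrite hE /bZ !lmx_mul lmx_tr !lmx_mul mxE.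
Qed.

(** Zero coordinates on an added summand: K stays in the smaller lattice and the involution is the
    identity on that summand. *)
Definition pad k (s : seq (seq int)) := [seq r ++ nseq k 0 | r <- s].

Definition U_inv12 : seq (seq int) := [:: [:: 0; 12]; [:: 12; 0]].
Definition U2_inv12 : seq (seq int) := [:: [:: 0; 6]; [:: 6; 0]].
Definition A2_inv12 : seq (seq int) := [:: [:: 8; 4]; [:: 4; 8]].
Definition D4_inv12 := lscale 6 4 4 D4_inverse2.
Definition E8_inv12 := lscale 12 8 8 E8_inverse.
Definition E8_2_inv12 := lscale 6 8 8 E8_inverse.
Definition E6_2_inv12 := lscale 2 6 6 E6_inverse3.

(* These bases were found by writing the lattice as an overlattice of M + E6(2)
   with M 2-elementary (e.g. U + A2 + 2 E8 is the index 3 overlattice of U + 3 E6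
   with its symmetry exchanging two copies of E6) and transporting E6(2) along an
   isometry. *)
Definition basis_U2_A2_D4 : seq (seq int) :=
  [:: [:: -2; 2; -2; 0; 1; -2; -1; -2];
      [:: 1; -1; 1; 0; -2; -2; -1; 0];
      [:: 0; 0; 0; 1; 0; 1; 1; 1];
      [:: 0; -1; 0; -1; 0; 1; 0; 0];
      [:: 1; 1; 0; 0; 0; 0; 0; 0];
      [:: -1; 0; 0; 0; 1; 0; 1; 0]].
Definition dual_U2_A2_D4 : seq (seq int) :=
  [:: [:: 1; -1; -1; 1; 0; 0; 1; -2];
      [:: 0; 0; 0; 0; -1; 0; 1; -1];
      [:: 0; 0; -1; 0; -1; 0; 1; 0];
      [:: 0; 0; -1; -1; -1; 0; 1; 0];
      [:: 0; 1; 0; -1; -1; 0; 1; 0];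
      [:: -1; 1; 1; -1; -1; 0; 1; 0]].

(** The sublattice of U(2) + A2 + D4 carried along the embedding of D4 on the branch node 3 of E8
    and its neighbours 1, 2, 4. *)
Definition basis_U2_A2_E8 : seq (seq int) :=
  [:: [:: -2; 2; -2; 0; 0; 1; -1; -2; -2; 0; 0; 0];
      [:: 1; -1; 1; 0; 0; -2; -1; -2; 0; 0; 0; 0];
      [:: 0; 0; 0; 1; 0; 0; 1; 1; 1; 0; 0; 0];
      [:: 0; -1; 0; -1; 0; 0; 0; 1; 0; 0; 0; 0];
      [:: 1; 1; 0; 0; 0; 0; 0; 0; 0; 0; 0; 0];
      [:: -1; 0; 0; 0; 0; 1; 1; 0; 0; 0; 0; 0]].
Definition dual_U2_A2_E8 : seq (seq int) :=
  [:: [:: 1; -1; -1; 1; 0; 0; 1; 0; -2; 0; 0; 0];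
      [:: 0; 0; 0; 0; 0; -1; 1; 0; -1; 0; 0; 0];
      [:: 0; 0; -1; 0; 0; -1; 1; 0; 0; 0; 0; 0];
      [:: 0; 0; -1; -1; 0; -1; 1; 0; 0; 0; 0; 0];
      [:: 0; 1; 0; -1; 0; -1; 1; 0; 0; 0; 0; 0];
      [:: -1; 1; 1; -1; 0; -1; 1; 0; 0; 0; 0; 0]].

Definition basis_U_A2_D4_D4 : seq (seq int) :=
  [:: [:: 6; -5; 4; 2; -2; 0; 1; 2; -2; -1; 1; -3];
      [:: 6; -6; 4; 2; -2; 1; 2; 3; -1; 1; 3; -1];
      [:: 0; -1; 0; 0; -1; -1; 0; -1; 0; 0; 1; 0];
      [:: -6; 7; -4; -2; 3; 0; -2; -2; 1; -1; -3; 2];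
      [:: 0; -1; 0; 0; -1; 0; 0; 0; 0; 1; 0; 0];
      [:: 0; 1; 0; 0; 1; 1; 1; 0; 1; 0; 0; 0]].
Definition dual_U_A2_D4_D4 : seq (seq int) :=
  [:: [:: 0; 0; 0; -1; -1; 1; 0; 0; 0; -1; 0; 0];
      [:: 0; 0; 0; 0; -1; 1; 0; 0; 0; -1; 0; 1];
      [:: 0; 0; 0; 1; -1; 1; 0; -1; 0; -1; 0; 1];
      [:: 1; 1; 0; 0; -1; 1; 0; -1; -1; 0; 0; 1];
      [:: 0; 0; 1; 0; -1; 1; 0; -1; 0; 0; -1; 1];
      [:: 0; 0; 0; 1; 0; 1; 0; -1; 0; 0; 0; 0]].

Definition basis_U_A2_E8_2 : seq (seq int) :=
  [:: [:: 0; 0; 0; 0; 0; -1; -1; -2; -2; -2; -1; 0];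
      [:: 0; 0; 0; 0; -2; -3; -4; -6; -5; -4; -3; -2];
      [:: -6; 6; -4; -2; 3; -1; 2; 2; 3; 4; 2; 0];
      [:: 6; -6; 4; 2; -2; 3; 0; 1; 0; -1; 0; 1];
      [:: 0; 0; 0; 0; 0; 0; 0; 1; 0; 0; 0; 0];
      [:: 0; 0; 0; 0; 0; 0; 0; 0; 1; 0; 0; 0]].
Definition dual_U_A2_E8_2 : seq (seq int) :=
  [:: [:: 0; 0; 0; -1; 0; 0; -1; 0; 0; 0; 0; 2];
      [:: 0; 0; 0; 0; 0; 0; -1; 0; 0; 0; 1; 0];
      [:: 0; 0; -1; 0; 0; 1; -2; 0; 0; 0; 1; 1];
      [:: 0; 0; 0; 0; 1; 1; -2; 0; 0; 0; 1; 0];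
      [:: 0; 0; 0; -1; 0; 0; -2; 1; 0; 0; 0; 1];
      [:: 0; 0; 0; 1; 0; -1; -1; 0; 1; 0; 0; 1]].

Definition basis_U2_A2_E8_2 : seq (seq int) :=
  [:: [:: 0; 0; 0; 0; -2; -3; -4; -6; -5; -4; -3; -2];
      [:: 12; -12; -8; 8; 1; 4; 0; -1; -7; -4; -1; 0];
      [:: -3; 3; 2; -2; 0; -1; 0; 0; 2; 1; 1; 1];
      [:: -3; 3; 2; -2; 0; 0; 1; 2; 3; 2; 0; 0];
      [:: -3; 3; 2; -2; 0; -1; 0; 1; 2; 1; 1; 0];
      [:: 6; -6; -4; 4; 1; 3; 2; 1; -2; -1; 0; 0]].
Definition dual_U2_A2_E8_2 : seq (seq int) :=
  [:: [:: 0; 0; 0; -1; 1; -1; 1; 1; -1; -1; -1; 1];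
      [:: 0; 0; 0; 0; -2; 0; 0; 1; 0; -1; 0; 1];
      [:: 0; 1; -1; 0; -1; 1; 0; 0; 1; -2; 0; 1];
      [:: 0; 0; 0; 0; -1; 0; 0; 1; 1; -2; -1; 1];
      [:: 0; 0; 0; -1; 1; 0; 0; 1; 0; -2; 0; 0];
      [:: 0; 1; -1; 0; 0; 0; 1; 0; 0; -1; 0; 0]].

Definition basis_U_A2_D4_E8 : seq (seq int) :=
  [:: [:: -1; -1; 0; 0; 0; 0; 0; 0; 2; 3; 4; 6; 5; 4; 3; 2];
      [:: -1; 1; 1; 1; 0; 0; 0; 0; 1; 0; 1; 1; 1; 2; 1; 0];
      [:: -1; 2; 1; 1; 0; 0; 0; -1; -2; -4; -4; -6; -4; -3; -2; -1];
      [:: 0; 0; 0; -1; 0; 0; 0; 0; 1; 1; 2; 2; 1; 0; 0; 0];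
      [:: 1; -1; -1; 0; 0; 0; 0; 0; 0; 1; -1; 0; 0; 0; 0; 0];
      [:: 1; -1; 0; 0; 0; 0; 0; 1; -2; -1; -2; -3; -3; -2; -1; 0]].
Definition dual_U_A2_D4_E8 : seq (seq int) :=
  [:: [:: 0; -1; 1; 0; 0; 0; 0; -1; 0; 0; 0; 0; 0; 0; 0; 0];
      [:: 0; 0; 1; 1; 0; 0; 0; 0; 0; 1; 0; 0; 0; 0; -1; 0];
      [:: 0; -1; 2; 0; 0; 0; 0; -1; 0; 0; -1; 1; 0; 0; -1; 0];
      [:: 0; 0; 1; 1; 0; 0; 0; -1; 0; 1; 0; 1; -1; -1; 0; 0];
      [:: 0; 0; 1; 0; 0; 0; 0; -1; 0; 1; -1; 1; -1; 0; 0; 0];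
      [:: 0; -1; 0; 1; 0; 0; 0; -1; 0; 0; 1; 0; -1; 0; 0; 0]].

Definition basis_U_A2_E8_E8 : seq (seq int) :=
  [:: [:: 0; 0; 0; 0; 0; 0; 0; 0; 0; 0; 0; 0; -1; -1; -2; -3; -3; -1; 0; 0];
      [:: -2; 3; 2; 1; 1; 0; 1; 0; 0; 0; 0; 0; 1; 0; 2; 1; 1; 1; 1; 2];
      [:: -1; 1; 0; 0; 1; 0; 1; 0; 0; 0; 0; 0; 1; 0; 2; 1; 1; 0; 0; 0];
      [:: 2; -2; -1; 0; -1; 0; -1; 0; 0; 0; 0; 0; -1; 0; -2; 0; 0; 0; 0; -1];
      [:: 1; -1; -1; -1; -1; 0; -1; 0; 0; 0; 0; 0; 0; 1; 1; 1; 1; 1; 0; 0];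
      [:: -1; 1; 1; 0; 1; 0; 1; 0; 0; 0; 0; 0; 1; 0; 0; 0; 0; 0; 0; 0]].
Definition dual_U_A2_E8_E8 : seq (seq int) :=
  [:: [:: 0; 0; 0; -1; 0; 0; 0; 0; 0; 0; 0; 0; 0; -1; 0; 0; 0; 0; 1; 0];
      [:: 0; 0; 0; 0; 0; 0; 0; 0; 0; 0; 0; 0; 0; 0; 0; 0; 0; 0; 1; 0];
      [:: 0; 0; -1; 0; 1; 0; 0; 0; 0; 0; 0; 0; 0; 0; 0; 0; 0; 0; 1; 0];
      [:: 1; 0; 0; 0; 1; 0; 0; 0; 0; 0; 0; 0; 0; 0; 0; 0; 0; 0; 1; 0];
      [:: 0; 0; 0; -1; 0; 0; 0; 0; 0; 0; 0; 0; 0; 0; 0; 0; 0; 0; 1; 0];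
      [:: 1; 0; 1; -1; 1; 0; 0; 0; 0; 0; 0; 0; 0; 0; 0; 0; 0; 0; 0; 0]].

(** Here K is an orthogonal summand, and its standard basis also serves as the dual system. *)
Definition basis_E6 := [seq 0 :: 0 :: r | r <- lscalar 1 6].

Lemma achiral_U2_A2_D4 : achiral (osum (osum (scale2 U) A2) D4).
Proof.
rewrite lmx_U /A2 /D4 !lmx_cartan ?lmx_scale2 !lmx_osum.
by apply: (@achiral_of_certificate _ _
  (losum 4 4 (losum 2 2 U2_inv12 A2_inv12) D4_inv12)
  basis_U2_A2_D4 dual_U2_A2_D4); vm_compute.
Qed.

Lemma achiral_U_E6_2 : achiral (osum U (scale2 E6)).
Proof.
rewrite lmx_U /E6 !lmx_cartan ?lmx_scale2 !lmx_osum.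
by apply: (@achiral_of_certificate _ _
  (losum 2 6 U_inv12 E6_2_inv12)
  basis_E6 basis_E6); vm_compute.
Qed.

Lemma achiral_U2_E6_2 : achiral (osum (scale2 U) (scale2 E6)).
Proof.
rewrite lmx_U /E6 !lmx_cartan ?lmx_scale2 !lmx_osum.
by apply: (@achiral_of_certificate _ _
  (losum 2 6 U2_inv12 E6_2_inv12)
  basis_E6 basis_E6); vm_compute.
Qed.

Lemma achiral_U2_A2_E8 : achiral (osum (osum (scale2 U) A2) E8).
Proof.
rewrite lmx_U /A2 /E8 !lmx_cartan ?lmx_scale2 !lmx_osum.
by apply: (@achiral_of_certificate _ _
  (losum 4 8 (losum 2 2 U2_inv12 A2_inv12) E8_inv12)
  basis_U2_A2_E8 dual_U2_A2_E8); vm_compute.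
Qed.

Lemma achiral_U_A2_D4_D4 : achiral (osum (osum (osum U A2) D4) D4).
Proof.
rewrite lmx_U /A2 /D4 !lmx_cartan ?lmx_scale2 !lmx_osum.
by apply: (@achiral_of_certificate _ _
  (losum 8 4 (losum 4 4 (losum 2 2 U_inv12 A2_inv12) D4_inv12) D4_inv12)
  basis_U_A2_D4_D4 dual_U_A2_D4_D4); vm_compute.
Qed.

Lemma achiral_U2_A2_D4_D4 : achiral (osum (osum (osum (scale2 U) A2) D4) D4).
Proof.
rewrite lmx_U /A2 /D4 !lmx_cartan ?lmx_scale2 !lmx_osum.
by apply: (@achiral_of_certificate _ _
  (losum 8 4 (losum 4 4 (losum 2 2 U2_inv12 A2_inv12) D4_inv12) D4_inv12) (pad 4 basis_U2_A2_D4)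
  (pad 4 dual_U2_A2_D4)); vm_compute.
Qed.

Lemma achiral_U_A2_E8_2 : achiral (osum (osum U A2) (scale2 E8)).
Proof.
rewrite lmx_U /A2 /E8 !lmx_cartan ?lmx_scale2 !lmx_osum.
by apply: (@achiral_of_certificate _ _
  (losum 4 8 (losum 2 2 U_inv12 A2_inv12) E8_2_inv12)
  basis_U_A2_E8_2 dual_U_A2_E8_2); vm_compute.
Qed.

Lemma achiral_U2_A2_E8_2 : achiral (osum (osum (scale2 U) A2) (scale2 E8)).
Proof.
rewrite lmx_U /A2 /E8 !lmx_cartan ?lmx_scale2 !lmx_osum.
by apply: (@achiral_of_certificate _ _
  (losum 4 8 (losum 2 2 U2_inv12 A2_inv12) E8_2_inv12)
  basis_U2_A2_E8_2 dual_U2_A2_E8_2); vm_compute.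
Qed.

Lemma achiral_U_A2_D4_E8 : achiral (osum (osum (osum U A2) D4) E8).
Proof.
rewrite lmx_U /A2 /D4 /E8 !lmx_cartan ?lmx_scale2 !lmx_osum.
by apply: (@achiral_of_certificate _ _
  (losum 8 8 (losum 4 4 (losum 2 2 U_inv12 A2_inv12) D4_inv12) E8_inv12)
  basis_U_A2_D4_E8 dual_U_A2_D4_E8); vm_compute.
Qed.

Lemma achiral_U2_A2_D4_E8 : achiral (osum (osum (osum (scale2 U) A2) D4) E8).
Proof.
rewrite lmx_U /A2 /D4 /E8 !lmx_cartan ?lmx_scale2 !lmx_osum.
by apply: (@achiral_of_certificate _ _
  (losum 8 8 (losum 4 4 (losum 2 2 U2_inv12 A2_inv12) D4_inv12) E8_inv12) (pad 8 basis_U2_A2_D4)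
  (pad 8 dual_U2_A2_D4)); vm_compute.
Qed.

Lemma achiral_U_A2_E8_E8 : achiral (osum (osum (osum U A2) E8) E8).
Proof.
rewrite lmx_U /A2 /E8 !lmx_cartan ?lmx_scale2 !lmx_osum.
by apply: (@achiral_of_certificate _ _
  (losum 12 8 (losum 4 8 (losum 2 2 U_inv12 A2_inv12) E8_inv12) E8_inv12)
  basis_U_A2_E8_E8 dual_U_A2_E8_E8); vm_compute.
Qed.

Lemma achiral_U2_A2_E8_E8 : achiral (osum (osum (osum (scale2 U) A2) E8) E8).
Proof.
rewrite lmx_U /A2 /E8 !lmx_cartan ?lmx_scale2 !lmx_osum.
by apply: (@achiral_of_certificate _ _
  (losum 12 8 (losum 4 8 (losum 2 2 U2_inv12 A2_inv12) E8_inv12) E8_inv12) (pad 8 basis_U2_A2_E8)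
  (pad 8 dual_U2_A2_E8)); vm_compute.
Qed.

Theorem theorem3p1 :
  (chiral (osum (U) (A2)) /\
   chiral (osum (scale2 U) (A2)) /\
   chiral (osum (osum (U) (A2)) (D4)) /\
   chiral (osum (osum (U) (A2)) (E8))) /\
  (achiral (osum (osum (scale2 U) (A2)) (D4)) /\
   achiral (osum (U) (scale2 E6)) /\
   achiral (osum (scale2 U) (scale2 E6)) /\
   achiral (osum (osum (scale2 U) (A2)) (E8)) /\
   achiral (osum (osum (osum (U) (A2)) (D4)) (D4)) /\
   achiral (osum (osum (osum (scale2 U) (A2)) (D4)) (D4)) /\
   achiral (osum (osum (U) (A2)) (scale2 E8)) /\
   achiral (osum (osum (scale2 U) (A2)) (scale2 E8)) /\
   achiral (osum (osum (osum (U) (A2)) (D4)) (E8)) /\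
   achiral (osum (osum (osum (scale2 U) (A2)) (D4)) (E8)) /\
   achiral (osum (osum (osum (U) (A2)) (E8)) (E8)) /\
   achiral (osum (osum (osum (scale2 U) (A2)) (E8)) (E8))).
Proof.
split.
  split; first exact: chiral_U_A2.
  split; first exact: chiral_U2_A2.
  by split; [exact: chiral_U_A2_D4 | exact: chiral_U_A2_E8].
split; first exact: achiral_U2_A2_D4.
split; first exact: achiral_U_E6_2.
split; first exact: achiral_U2_E6_2.
split; first exact: achiral_U2_A2_E8.
split; first exact: achiral_U_A2_D4_D4.
split; first exact: achiral_U2_A2_D4_D4.
split; first exact: achiral_U_A2_E8_2.
split; first exact: achiral_U2_A2_E8_2.
split; first exact: achiral_U_A2_D4_E8.
split; first exact: achiral_U2_A2_D4_E8.
by split; [exact: achiral_U_A2_E8_E8 | exact: achiral_U2_A2_E8_E8].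
Qed.
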